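(* Let $\mathcal T=\{T_s\}_{s\ge 0}$ be a semigroup of Dunford-Schwartz operators that is strongly continuous in $\mathcal L^1$. Given $1\le p<\infty$ and $f\in\mathcal L^p$, the averages $M_t(\mathcal T)(f)=\frac1t\int_0^tT_s(f)\,ds$ converge almost uniformly to $f$ as $t\to0^+$.
   Context: Let $(\Omega,\mathcal A,\mu)$ be a $\sigma$-finite measure space with $\mu(\Omega)=\infty$. $\mathcal L^0$ is the algebra of equivalence classes of a.e. finite complex-valued measurable functions on $\Omega$, and $\mathcal L^p=\mathcal L^p(\Omega,\mu)\subset\mathcal L^0$ ($1\le p\le\infty$) is the usual space with norm $\|\cdot\|_p$. A Dunford-Schwartz operator ($T\in DS$) is a linear operator $T:\mathcal L^1\to\mathcal L^1$ with $\|T(f)\|_1\le\|f\|_1$ for all $f\in\mathcal L^1$ and $\|T(f)\|_\infty\le\|f\|_\infty$ for all $f\in\mathcal L^1\cap\mathcal L^\infty$. Such $T$ is identified with its unique linear extension to $\mathcal L^1+\mathcal L^\infty$ that contracts $\mathcal L^\infty$ and whose restriction to $\mathcal L^\infty$ is $\sigma(\mathcal L^\infty,\mathcal L^1)$-continuous; the extension also contracts every $\mathcal L^p$, $1<p<\infty$. A semigroup $\{T_s\}_{s\ge0}\subset DS$ satisfies $T_0=I$ and $T_{r+s}=T_rT_s$ for $r,s\ge0$. It is strongly continuous in $\mathcal L^1$ if $\|T_s(f)-T_{s_0}(f)\|_1\to0$ whenever $s\to s_0$, for all $f\in\mathcal L^1$. For $f\in\mathcal L^p$, $1\le p<\infty$,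 the integral $\int_0^tT_s(f)\,ds$ is a Bochner integral in $\mathcal L^p$. A net $\{f_\alpha\}\subset\mathcal L^0$ converges almost uniformly (a.u.) to $f\in\mathcal L^0$ if for every $\varepsilon>0$ there is a measurable set $G\subset\Omega$ with $\mu(\Omega\setminus G)\le\varepsilon$ and $\|(f-f_\alpha)\chi_G\|_\infty\to0$. *)

(* Defs.v *)
From HB Require Import structures.
From mathcomp Require Import all_boot all_order all_algebra.
From mathcomp Require Import all_classical all_reals all_analysis.
From mathcomp Require Import complex.

Set Implicit Arguments.
Unset Strict Implicit.
Unset Printing Implicit Defensive.

Import Order.TTheory GRing.Theory Num.Theory.
Import numFieldNormedType.Exports.

Local Open Scope classical_set_scope.
Local Open Scope ring_scope.
Local Open Scope complex_scope.

(* Elements of L^0 are handled through representatives, i.e. everywhere defined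
   functions Omega -> R[i]; equalities between elements of L^0 are stated as
   equalities mu-almost everywhere, and an operator on a space of classes is a
   map on representatives.  The linearity and contraction clauses below force
   such a map to send a.e. equal functions to a.e. equal functions. *)

Section ComplexLp.
Context {d : measure_display} {Omega : measurableType d} {R : realType}.
Variable mu : {measure set Omega -> \bar R}.
Implicit Types (f g h : Omega -> R[i]) (p : \bar R).

Definition cmeasurable f : Prop :=
  measurable_fun [set: Omega] (fun x => complex.Re (f x)) /\
  measurable_fun [set: Omega] (fun x => complex.Im (f x)).

Definition cnorm p f : \bar R :=
  Lnorm mu p (fun x => (ComplexField.Normc.normc (f x))%:E).

Definition cdist p f g : \bar R := cnorm p (fun x => f x - g x).

Definition cLp p : set (Omega -> R[i]) :=
  [set f | cmeasurable f /\ (cnorm p f < +oo)%E].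

Definition L1_plus_Loo : set (Omega -> R[i]) :=
  [set f : Omega -> R[i] | exists g h, [/\ cLp 1 g, cLp +oo h & f = (fun x => g x + h x)]].

Definition cintegral f : R[i] :=
  (\int[mu]_x complex.Re (f x))%R +i* (\int[mu]_x complex.Im (f x))%R.

(* Convergence of a filter to f0 in the topology sigma(L^oo, L^1). *)
Definition weakstar_cvg (F : set_system (Omega -> R[i])) f0 : Prop :=
  forall g, cLp 1 g ->
    ComplexField.Normc.normc
      (cintegral (fun x => f x * g x) - cintegral (fun x => f0 x * g x))
    @[f --> F] --> (0 : R).

(* sigma(L^oo, L^1)-continuity of the restriction of S to L^oo: S preserves the
   convergence of filters that live on L^oo. *)
Definition weakstar_continuous (S : (Omega -> R[i]) -> (Omega -> R[i])) : Prop :=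
  forall (F : set_system (Omega -> R[i])) f0, ProperFilter F ->
    F (cLp +oo) -> cLp +oo f0 ->
    weakstar_cvg F f0 -> weakstar_cvg (S @ F) (S f0).

Definition linear_on (E : set (Omega -> R[i]))
    (S : (Omega -> R[i]) -> (Omega -> R[i])) : Prop :=
  forall (a : R[i]) f g, E f -> E g ->
    \forall x \ae mu, S (fun y => a * f y + g y) x = a * S f x + S g x.

Definition dunford_schwartz (T : (Omega -> R[i]) -> (Omega -> R[i])) : Prop :=
  [/\ forall f, cLp 1 f -> cLp 1 (T f),
      linear_on (cLp 1) T,
      forall f, cLp 1 f -> (cnorm 1 (T f) <= cnorm 1 f)%E &
      forall f, cLp 1 f -> cLp +oo f -> (cnorm +oo (T f) <= cnorm +oo f)%E].

(* Text is (a version of) the extension to L^1 + L^oo of the operator T on L^1. *)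
Definition ds_extension (T Text : (Omega -> R[i]) -> (Omega -> R[i])) : Prop :=
  [/\ forall f, L1_plus_Loo f -> L1_plus_Loo (Text f),
      linear_on L1_plus_Loo Text,
      forall f, cLp 1 f -> \forall x \ae mu, Text f x = T f x,
      forall f, cLp +oo f -> (cnorm +oo (Text f) <= cnorm +oo f)%E &
      weakstar_continuous Text].

(* Families indexed by s >= 0; the values at s < 0 are irrelevant. *)
Definition ds_semigroup (T : R -> (Omega -> R[i]) -> (Omega -> R[i])) : Prop :=
  [/\ forall s, 0 <= s -> dunford_schwartz (T s),
      forall f, cLp 1 f -> \forall x \ae mu, T 0 f x = f x &
      forall r s f, 0 <= r -> 0 <= s -> cLp 1 f ->
        \forall x \ae mu, T (r + s) f x = T r (T s f) x].

Definition strongly_continuous_L1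
    (T : R -> (Omega -> R[i]) -> (Omega -> R[i])) : Prop :=
  forall f s0, cLp 1 f -> 0 <= s0 ->
    cdist 1 (T s f) (T s0 f)
    @[s --> within [set s | 0 <= s] (nbhs s0)] --> 0%E.

(* The simple function s |-> \sum_i \1_(A_i) s * g_i on `[a, b] with values
   in L^p is encoded by the list of the pairs (A_i, g_i). *)
Definition is_simple p (a b : R) (G : seq (set R * (Omega -> R[i]))) : Prop :=
  forall i, (i < size G)%N ->
    let Ag := nth (set0, fun=> 0) G i in
    [/\ measurable Ag.1, Ag.1 `<=` `[a, b] & cLp p Ag.2].

Definition simple_val (G : seq (set R * (Omega -> R[i]))) (s : R) :
    Omega -> R[i] :=
  fun x => \sum_(Ag <- G) (\1_(Ag.1) s : R)%:C * Ag.2 x.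

Definition simple_integral (G : seq (set R * (Omega -> R[i]))) : Omega -> R[i] :=
  fun x => \sum_(Ag <- G) (fine (lebesgue_measure Ag.1))%:C * Ag.2 x.

(* I is the Bochner integral over `[a, b] of the L^p-valued function H: there
   are simple functions G_n with G_n -> H a.e. in norm (strong measurability),
   \int ||H - G_n||_p -> 0 and \int G_n -> I in L^p. *)
Definition is_bochner_integral p (a b : R) (H : R -> Omega -> R[i])
    (I : Omega -> R[i]) : Prop :=
  [/\ forall s, a <= s <= b -> cLp p (H s),
      cLp p I &
      exists G : nat -> seq (set R * (Omega -> R[i])),
      [/\ forall n, is_simple p a b (G n),
          \forall s \ae (@lebesgue_measure R), a <= s <= b ->
            cdist p (H s) (simple_val (G n) s)
            @[n --> \oo] --> 0%E,
          (\int[@lebesgue_measure R]_(s in `[a, b])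
             cdist p (H s) (simple_val (G n) s))%E
          @[n --> \oo] --> 0%E &
          cdist p I (simple_integral (G n))
          @[n --> \oo] --> 0%E]].

(* The value is 0 when H is not Bochner integrable. *)
Definition bochner_integral p (a b : R) (H : R -> Omega -> R[i]) :
    Omega -> R[i] :=
  xget (fun=> 0) [set I | is_bochner_integral p a b H I].

Definition ds_average p (T : R -> (Omega -> R[i]) -> (Omega -> R[i]))
    (t : R) f : Omega -> R[i] :=
  fun x => (t^-1)%:C * bochner_integral p 0 t (fun s => T s f) x.

Definition cvg_au {I : Type} (F : set_system I) (u : I -> Omega -> R[i]) f :
    Prop :=
  forall e : R, 0 < e -> exists G : set Omega,
    [/\ measurable G, (mu (~` G) <= e%:E)%E &
        cnorm +oo (fun x => (f x - u i x) * (\1_G x : R)%:C)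
        @[i --> F] --> 0%E].

End ComplexLp.

(* Main.v *)
(* Let [A_t f] be the average of the orbit of [f] over [0, t].  If [h] is bounded and
   integrable, then [g = A_r h] satisfies [|T_s g - g| <= C s] almost everywhere, since
   [T_s] merely shifts the integral defining [g]; hence [A_t g -> g] uniformly.  Such [g]
   are dense in L^1, so a function of L^p splits as [f = g + r + k] with [r] small in L^1
   and [|k| <= a].  The averages of [k] are again bounded by [a], and those of [r] are
   bounded by [a] off a set of measure at most [2 |r|_1 / a], by a maximal inequality.

   For one Dunford-Schwartz operator the maximal inequality comes from Chacon's filling
   scheme, which needs neither positivity nor a linear modulus; for the semigroup it
   follows by passing to the limit in Riemann sums, first at countably many times.

   That the Bochner integrals exist in L^p rests on the boundedness of the extensions
   on L^p, obtained from [int (|S f| - a)^+ <= int (|f| - a)^+] for all [a > 0]. *)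

(* A Bochner integral is only a limit in norm, and here also an arbitrary representative, so nothing
   is known about it pointwise. Every pointwise bound is therefore proved for Riemann sums, where
   countably many null sets are discarded, and reaches the integral by convergence in measure. The
   splitting f = g + r + k is likewise made on Riemann sums: the average of f is an integral in L^p,
   that of r one in L^1, and the two are never compared as integrals.

   The parameter t ranges over an uncountable set. Almost uniform convergence measures each average
   by an essential supremum, so every t may have its own null set, but the removed set of positive
   measure must serve all t at once. In the maximal inequality that set is built from rational
   times; other times are reached because the integral over [0, t] is Lipschitz in t for the L^1
   norm. The filling scheme is run at level a/2 and the other half of a pays for the Riemann error,
   whence the factor 2 in 2 |r|_1 / a. *)
Require Import Defs.
From mathcomp Require Import all_boot all_order all_algebra.
From mathcomp Require Import all_classical all_reals all_analysis.
From mathcomp Require Import measurable_realfun ess_sup_inf.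
From mathcomp Require Import complex ring lra.

Set Implicit Arguments.
Unset Strict Implicit.
Unset Printing Implicit Defensive.

Import Order.TTheory GRing.Theory Num.Theory.
Import numFieldNormedType.Exports.
Import ComplexField.Normc.

Local Open Scope classical_set_scope.
Local Open Scope ring_scope.
Local Open Scope complex_scope.

Local Notation Re := complex.Re.
Local Notation Im := complex.Im.


(** * The modulus on complex-valued functions *)

Section ComplexModulus.
Context {R : realType}.
Implicit Types (z w : R[i]) (a : R).

Lemma normc_ge0 z : 0 <= normc z.
Proof. by case: z => a b; exact: sqrtr_ge0. Qed.

Lemma normcD z w : normc (z + w) <= normc z + normc w.
Proof. exact: le_normcD. Qed.

Lemma normcN z : normc (- z) = normc z.
Proof. exact: complex.normcN. Qed.

Lemma normcB z w : normc (z - w) <= normc z + normc w.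
Proof. by rewrite -(normcN w) normcD. Qed.

Lemma normc_distC z w : normc (z - w) = normc (w - z).
Proof. by rewrite -normcN opprB. Qed.

Lemma normcR a : normc a%:C = `|a|.
Proof. by rewrite /= expr0n/= addr0 sqrtr_sqr. Qed.

Lemma normc_sum (I : Type) (s : seq I) (F : I -> R[i]) :
  normc (\sum_(i <- s) F i) <= \sum_(i <- s) normc (F i).
Proof.
elim/big_rec2 : _ => [|i y1 y2 _ h]; first by rewrite normc0.
by rewrite (le_trans (normcD _ _))// lerD2l.
Qed.

Lemma normc_leD z : normc z <= `|Re z| + `|Im z|.
Proof.
case: z => a b /=; rewrite -[leRHS]ger0_norm ?addr_ge0// -sqrtr_sqr.
rewrite ler_sqrt ?sqr_ge0// -(real_normK (num_real a)) -(real_normK (num_real b)).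
by rewrite sqrrD lerD2r lerDl mulrn_wge0// mulr_ge0.
Qed.

Lemma normr_Re_le z : `|Re z| <= normc z.
Proof.
case: z => a b /=; rewrite -sqrtr_sqr ler_sqrt; last by rewrite addr_ge0 ?sqr_ge0.
by rewrite lerDl sqr_ge0.
Qed.

Lemma normr_Im_le z : `|Im z| <= normc z.
Proof.
case: z => a b /=; rewrite -sqrtr_sqr ler_sqrt; last by rewrite addr_ge0 ?sqr_ge0.
by rewrite lerDr sqr_ge0.
Qed.

Lemma ReD z w : Re (z + w) = Re z + Re w. Proof. by case: z; case: w. Qed.
Lemma ImD z w : Im (z + w) = Im z + Im w. Proof. by case: z; case: w. Qed.
Lemma ReM z w : Re (z * w) = Re z * Re w - Im z * Im w.
Proof. by case: z; case: w. Qed.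
Lemma ImM z w : Im (z * w) = Re z * Im w + Im z * Re w.
Proof. by case: z; case: w. Qed.

End ComplexModulus.

Section ComplexMeasurable.
Context {d : measure_display} {Omega : measurableType d} {R : realType}.
Implicit Types (f g : Omega -> R[i]).

Lemma cmeasurable_cst (a : R[i]) : cmeasurable (fun _ : Omega => a).
Proof. by split; exact: measurable_cst. Qed.

Lemma cmeasurableD f g : cmeasurable f -> cmeasurable g ->
  cmeasurable (fun x => f x + g x).
Proof.
move=> [f1 f2] [g1 g2]; split.
  by under eq_fun do rewrite ReD; exact: measurable_funD.
by under eq_fun do rewrite ImD; exact: measurable_funD.
Qed.

Lemma cmeasurableM f g : cmeasurable f -> cmeasurable g ->
  cmeasurable (fun x => f x * g x).
Proof.
move=> [f1 f2] [g1 g2]; split.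
  by under eq_fun do rewrite ReM; apply: measurable_funB; exact: measurable_funM.
by under eq_fun do rewrite ImM; apply: measurable_funD; exact: measurable_funM.
Qed.

Lemma cmeasurableZ a f : cmeasurable f -> cmeasurable (fun x => a * f x).
Proof. by move=> mf; apply: cmeasurableM => //; exact: cmeasurable_cst. Qed.

Lemma cmeasurableN f : cmeasurable f -> cmeasurable (fun x => - f x).
Proof.
by move=> mf; under eq_fun do rewrite -mulN1r; exact: cmeasurableZ.
Qed.

Lemma cmeasurableB f g : cmeasurable f -> cmeasurable g ->
  cmeasurable (fun x => f x - g x).
Proof. by move=> mf mg; apply: cmeasurableD => //; exact: cmeasurableN. Qed.

Lemma cmeasurable_sum (I : Type) (s : seq I) (F : I -> Omega -> R[i]) :
  (forall i, cmeasurable (F i)) -> cmeasurable (fun x => \sum_(i <- s) F i x).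
Proof.
move=> mF; elim: s => [|i s ih].
  by under eq_fun do rewrite big_nil; exact: cmeasurable_cst.
by under eq_fun do rewrite big_cons; exact: cmeasurableD.
Qed.

Lemma cmeasurable_real (c : Omega -> R) : measurable_fun setT c ->
  cmeasurable (fun x => (c x)%:C).
Proof. by move=> mc; split => //; exact: measurable_cst. Qed.

Lemma measurable_normc f : cmeasurable f ->
  measurable_fun setT (fun x => normc (f x)).
Proof.
move=> [f1 f2]; rewrite (_ : (fun x => _) =
  Num.sqrt \o (fun x => Re (f x) ^+ 2 + Im (f x) ^+ 2)).
  apply: measurableT_comp.
    by apply: continuous_measurable_fun; exact: sqrt_continuous.
  by apply: measurable_funD; exact: measurable_funX.
by apply/funext => x /=; case: (f x).
Qed.

Lemma measurable_normcE f : cmeasurable f ->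
  measurable_fun setT (fun x => (normc (f x))%:E).
Proof. by move=> mf; apply/measurable_EFinP; exact: measurable_normc. Qed.

(** Radial truncation: the phase is kept and the modulus cut down to [c x]. Where [f x = 0] the
    quotient is 0 by convention and the product vanishes anyway. *)
Definition ctrunc (c : Omega -> R) f x : R[i] :=
  (Num.min 1 (c x / normc (f x)))%:C * f x.

Lemma cmeasurable_ctrunc c f : measurable_fun setT c -> cmeasurable f ->
  cmeasurable (ctrunc c f).
Proof.
move=> mc mf; apply: cmeasurableM => //; apply: cmeasurable_real.
apply: measurable_minr => //.
apply: measurable_funM => //.
(* The inverse modulus is written as a real power, which is a measurable function on the whole line;
   both vanish at 0. *)
rewrite (_ : (fun x => _) = (@powR R ^~ (-1)) \o (fun x => normc (f x))).
  by apply: measurableT_comp; [exact: measurable_powR|exact: measurable_normc].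
by apply/funext => x /=; rewrite powR_inv1// normc_ge0.
Qed.

Lemma normc_ctrunc c f x : 0 <= c x ->
  normc (ctrunc c f x) = Num.min (normc (f x)) (c x).
Proof.
move=> c0; rewrite normcM normcR ger0_norm; last first.
  by rewrite le_min ler01 divr_ge0// normc_ge0.
have [->|f0] := eqVneq (normc (f x)) 0; first by rewrite mulr0 min_l.
by rewrite minr_pMl ?normc_ge0// mul1r divfK.
Qed.

(** The truncation is a multiple of [f x] by a factor in [0, 1], so no cancellation occurs and the
    two moduli add up to [normc (f x)]. This additivity is what makes the mass balance of the
    filling scheme exact. *)
Lemma normc_sub_ctrunc c f x : 0 <= c x ->
  normc (f x - ctrunc c f x) = normc (f x) - Num.min (normc (f x)) (c x).
Proof.
move=> c0; rewrite -(normc_ctrunc f c0) /ctrunc -{1}[f x]mul1r -mulrBl.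
rewrite (_ : 1 - _ = (1 - Num.min 1 (c x / normc (f x)))%:C); last first.
  by rewrite rmorphB.
rewrite !normcM !normcR !ger0_norm ?le_min ?ler01 ?divr_ge0 ?normc_ge0//.
  by rewrite mulrBl mul1r.
by rewrite subr_ge0 ge_min lexx.
Qed.

End ComplexMeasurable.

(** * Seminorms of complex-valued functions *)

Lemma ge0_cvge0P {R : realType} {I : Type} (F : set_system I) {FF : Filter F} (u : I -> \bar R) :
  (forall i, 0 <= u i)%E ->
  u i @[i --> F] --> 0%E <-> (forall e : R, 0 < e -> \forall i \near F, (u i <= e%:E)%E).
Proof.
move=> u0; split => [/fine_cvgP[fu /cvgrPdist_le cu] e e0|H].
  apply: filterS2 fu (cu e e0) => i fui; rewrite sub0r normrN.
  by rewrite ger0_norm ?fine_ge0// -lee_fin fineK.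
apply/fine_cvgP; split.
  apply: filterS (H 1 ltr01) => i ui.
  by rewrite ge0_fin_numE// (le_lt_trans ui)// ltry.
apply/cvgrPdist_le => e e0; apply: filterS (H e e0) => i ui.
rewrite sub0r normrN ger0_norm ?fine_ge0// -lee_fin fineK//.
by rewrite ge0_fin_numE// (le_lt_trans ui)// ltry.
Qed.

Section Lp.
Context {d : measure_display} {Omega : measurableType d} {R : realType}.
Variable mu : {measure set Omega -> \bar R}.
Implicit Types (f g h : Omega -> R[i]) (p : R).
Local Open Scope ereal_scope.

Lemma cnorm_ge0 q f : 0 <= cnorm mu q f. Proof. exact: Lnorm_ge0. Qed.
Hint Resolve cnorm_ge0 : core.

Lemma measurable_normc_powR p f : cmeasurable f ->
  measurable_fun setT (fun x => (normc (f x) `^ p)%:E).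
Proof.
move=> mf; apply/measurable_EFinP.
apply: (@measurableT_comp _ _ _ _ _ _ (@powR R ^~ p)) => //.
exact: measurable_normc.
Qed.

Lemma cnorm_poweR p f : (0 < p)%R ->
  cnorm mu p%:E f `^ p = \int[mu]_x (normc (f x) `^ p)%:E.
Proof.
move=> p0; rewrite /cnorm (poweR_Lnorm mu _ (lt0r_neq0 p0)).
by apply: eq_integral => x _; rewrite /= ger0_norm ?normc_ge0.
Qed.

Lemma cnorm1E f : cnorm mu 1 f = \int[mu]_x (normc (f x))%:E.
Proof.
rewrite /cnorm Lnorm1; apply: eq_integral => x _.
by rewrite gee0_abs ?lee_fin ?normc_ge0.
Qed.

(** Lets norms, possibly infinite, be compared through their p-th powers, which are plain
    integrals. *)
Lemma lee_poweR_inv p (x y : \bar R) : (0 < p)%R -> 0 <= x -> 0 <= y ->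
  (x `^ p <= y `^ p) = (x <= y).
Proof.
move=> p0 x0 y0; apply/idP/idP => [h|h]; last first.
  by apply: gt0_ler_poweR => //; rewrite ?in_itv/= ?leey ?x0 ?y0 ?ltW.
have : (x `^ p) `^ p^-1 <= (y `^ p) `^ p^-1.
  by apply: gt0_ler_poweR; rewrite ?in_itv/= ?invr_ge0 ?(ltW p0) ?poweR_ge0 ?leey.
by rewrite -!poweRrM divff ?gt_eqF// !poweRe1.
Qed.

Lemma le_cnorm p f g : (0 < p)%R -> cmeasurable f -> cmeasurable g ->
  (\forall x \ae mu, (normc (f x) <= normc (g x))%R) ->
  cnorm mu p%:E f <= cnorm mu p%:E g.
Proof.
move=> p0 mf mg fg.
rewrite -(lee_poweR_inv p0 (cnorm_ge0 _ _) (cnorm_ge0 _ _)) !(cnorm_poweR _ p0).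
apply: ae_ge0_le_integral => //.
- by move=> x _; rewrite lee_fin powR_ge0.
- exact: measurable_normc_powR.
- by move=> x _; rewrite lee_fin powR_ge0.
- exact: measurable_normc_powR.
apply: filterS fg => x fgx _; rewrite lee_fin.
by apply: ge0_ler_powR => //; rewrite ?nnegrE ?normc_ge0 ?ltW.
Qed.

Lemma eq_cnorm p f g : (0 < p)%R -> cmeasurable f -> cmeasurable g ->
  (\forall x \ae mu, f x = g x) -> cnorm mu p%:E f = cnorm mu p%:E g.
Proof.
move=> p0 mf mg fg; apply/eqP; rewrite eq_le !le_cnorm//.
  by apply: filterS fg => x ->.
by apply: filterS fg => x ->.
Qed.

Lemma cnormD p f g : (1 <= p)%R -> cmeasurable f -> cmeasurable g ->
  cnorm mu p%:E (fun x => f x + g x)%R <= cnorm mu p%:E f + cnorm mu p%:E g.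
Proof.
move=> p1 mf mg; have p0 : (0 < p)%R by rewrite (lt_le_trans _ p1).
have mf' := measurable_normc mf; have mg' := measurable_normc mg.
apply: le_trans (minkowski_EFin mu mf' mg' p1).
have -> : 'N[mu]_(p%:E)[EFin \o ((fun x => normc (f x)) \+ (fun x => normc (g x)))%R]
  = cnorm mu p%:E (fun x => (normc (f x) + normc (g x))%:C)%R.
  apply: eq_Lnorm => x /=.
  by rewrite expr0n/= addr0 sqrtr_sqr ger0_norm// addr_ge0 ?normc_ge0.
apply: le_cnorm => //; first exact: cmeasurableD.
  by apply: cmeasurable_real; exact: measurable_funD.
apply: nearW => x; rewrite normcR ger0_norm ?addr_ge0 ?normc_ge0//.
exact: normcD.
Qed.

Lemma cnormZ p (a : R[i]) f : (0 < p)%R -> cmeasurable f ->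
  cnorm mu p%:E (fun x => a * f x)%R = (normc a)%:E * cnorm mu p%:E f.
Proof.
move=> p0 mf; have a0 := normc_ge0 a.
have n0 : 0 <= (normc a)%:E * cnorm mu p%:E f by rewrite mule_ge0.
have E : cnorm mu p%:E (fun x => a * f x)%R `^ p = ((normc a)%:E * cnorm mu p%:E f) `^ p.
  rewrite poweRM// !cnorm_poweR// poweR_EFin -ge0_integralZl//=; last 3 first.
  - exact: measurable_normc_powR.
  - by move=> x _; rewrite lee_fin powR_ge0.
  - by rewrite lee_fin powR_ge0.
  by apply: eq_integral => x _; rewrite -EFinM normcM powRM ?normc_ge0.
by apply/eqP; rewrite eq_le; apply/andP; split; rewrite -(lee_poweR_inv p0)// E.
Qed.

Lemma cdistC q f g : cdist mu q f g = cdist mu q g f.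
Proof. by apply: eq_Lnorm => x; rewrite normc_distC. Qed.

Lemma cdist_triangle p g f h : (1 <= p)%R ->
  cmeasurable f -> cmeasurable g -> cmeasurable h ->
  cdist mu p%:E f h <= cdist mu p%:E f g + cdist mu p%:E g h.
Proof.
move=> p1 mf mg mh; rewrite /cdist.
rewrite (_ : (fun x => f x - h x)%R = (fun x => (f x - g x) + (g x - h x))%R).
  by apply: cnormD => //; exact: cmeasurableB.
by apply/funext => x; rewrite addrA subrK.
Qed.

Lemma cnorm0 p : (0 < p)%R -> cnorm mu p%:E (fun=> 0%R) = 0.
Proof.
move=> p0; rewrite -[RHS](@Lnorm0 _ _ _ mu p%:E) ?eqe ?gt_eqF//.
by apply: eq_Lnorm => x; rewrite normc0.
Qed.

Lemma cnorm_sum p (I : Type) (s : seq I) (F : I -> Omega -> R[i]) : (1 <= p)%R ->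
  (forall i, cmeasurable (F i)) ->
  cnorm mu p%:E (fun x => \sum_(i <- s) F i x)%R <= \sum_(i <- s) cnorm mu p%:E (F i).
Proof.
move=> p1 mF; have p0 : (0 < p)%R by rewrite (lt_le_trans _ p1).
elim: s => [|i s ih]; first by under eq_fun do rewrite big_nil; rewrite big_nil cnorm0.
under eq_fun do rewrite big_cons; rewrite big_cons.
apply: le_trans; first by apply: cnormD => //; exact: cmeasurable_sum.
exact: leeD2l.
Qed.

Lemma cLp_measurable q f : cLp mu q f -> cmeasurable f. Proof. by case. Qed.

Lemma cLp_fin_num q f : cLp mu q f -> cnorm mu q f \is a fin_num.
Proof. by case=> _ h; rewrite ge0_fin_numE. Qed.

Lemma cLpD p f g : (1 <= p)%R -> cLp mu p%:E f -> cLp mu p%:E g ->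
  cLp mu p%:E (fun x => f x + g x)%R.
Proof.
move=> p1 [mf f1] [mg g1]; split; first exact: cmeasurableD.
by rewrite (le_lt_trans (cnormD p1 mf mg))// lte_add_pinfty.
Qed.

Lemma cLpZ p a f : (0 < p)%R -> cLp mu p%:E f -> cLp mu p%:E (fun x => a * f x)%R.
Proof.
move=> p0 [mf f1]; split; first exact: cmeasurableZ.
by rewrite cnormZ// lte_mul_pinfty// lee_fin normc_ge0.
Qed.

Lemma cLpB p f g : (1 <= p)%R -> cLp mu p%:E f -> cLp mu p%:E g ->
  cLp mu p%:E (fun x => f x - g x)%R.
Proof.
move=> p1 Lf Lg; apply: cLpD => //; under eq_fun do rewrite -mulN1r.
by apply: cLpZ => //; rewrite (lt_le_trans _ p1).
Qed.

Lemma cLp0 p : (0 < p)%R -> cLp mu p%:E (fun=> 0%R).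
Proof. by move=> p0; split; [exact: cmeasurable_cst|rewrite cnorm0]. Qed.

Lemma cLp_sum p (I : Type) (s : seq I) (F : I -> Omega -> R[i]) : (1 <= p)%R ->
  (forall i, cLp mu p%:E (F i)) -> cLp mu p%:E (fun x => \sum_(i <- s) F i x)%R.
Proof.
move=> p1 mF; have p0 : (0 < p)%R by rewrite (lt_le_trans _ p1).
elim: s => [|i s ih]; first by under eq_fun do rewrite big_nil; exact: cLp0.
by under eq_fun do rewrite big_cons; exact: cLpD.
Qed.

Lemma le_cLp p f g : (0 < p)%R -> cmeasurable f -> cLp mu p%:E g ->
  (\forall x \ae mu, (normc (f x) <= normc (g x))%R) -> cLp mu p%:E f.
Proof.
move=> p0 mf [mg g1] fg; split => //.
by rewrite (le_lt_trans _ g1)// le_cnorm.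
Qed.

Lemma cnorm_eq0_ae p f : (0 < p)%R -> cmeasurable f -> cnorm mu p%:E f = 0 ->
  \forall x \ae mu, f x = 0%R.
Proof.
move=> p0 mf /(Lnorm_eq0_eq0 (measurable_normcE mf)).
rewrite lte_fin => /(_ p0); apply: filterS => x /(_ I) /eqP.
by rewrite eqe => /eqP /eq0_normc.
Qed.

Lemma cnormy_le f (c : R) : (0 <= c)%R ->
  (\forall x \ae mu, (normc (f x) <= c)%R) -> cnorm mu +oo f <= c%:E.
Proof.
move=> c0 fc; rewrite /cnorm unlock /=; case: ifPn => // _.
by apply/ess_supP; apply: filterS fc => x; rewrite /= ger0_norm ?normc_ge0.
Qed.

Lemma le_cnormy f (c : R) : cnorm mu +oo f <= c%:E ->
  \forall x \ae mu, (normc (f x) <= c)%R.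
Proof.
rewrite /cnorm unlock /=; case: ifPn => [_ /ess_supP|].
  by apply: filterS => x; rewrite /= ger0_norm ?normc_ge0.
(* On a space of measure zero the norm is 0 by convention, and every property holds almost
   everywhere. *)
rewrite -leNgt => mu0 _.
have muT : mu setT = 0 by apply/eqP; rewrite eq_le mu0/=.
by exists setT; split.
Qed.

Lemma cLpy f (c : R) : (0 <= c)%R -> cmeasurable f ->
  (\forall x \ae mu, (normc (f x) <= c)%R) -> cLp mu +oo f.
Proof.
by move=> c0 mf fc; split => //; rewrite (le_lt_trans (cnormy_le c0 fc)) ?ltry.
Qed.

Lemma cnorm_markov p f (e : R) : (0 < p)%R -> (0 < e)%R -> cmeasurable f ->
  (e `^ p)%:E * mu [set x | (e <= normc (f x))%R] <= cnorm mu p%:E f `^ p.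
Proof.
move=> p0 e0 mf; rewrite cnorm_poweR//.
have := @le_integral_comp_abse _ _ _ mu setT measurableT
  (fun x => (normc (f x))%:E) e (fun y => y `^ p).
rewrite setTI => /(_ (@measurable_poweR R p) _ _ (measurable_normcE mf) e0).
rewrite (_ : [set x | _] = [set x | (e <= normc (f x))%R]); last first.
  by apply/seteqP; split=> x /=; rewrite lee_fin ger0_norm ?normc_ge0.
rewrite (_ : (\int[_]_(_ in _) _) = \int[mu]_x (normc (f x) `^ p)%:E).
  apply; first by move=> r _; exact: poweR_ge0.
  move=> x y; rewrite !inE/= !in_itv/= !andbT => x0 y0 xy.
  by apply: gt0_ler_poweR => //; rewrite ?in_itv/= ?x0 ?y0 ?leey ?(ltW p0).
by apply: eq_integral => x _; rewrite gee0_abs ?lee_fin ?normc_ge0.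
Qed.

(** Markov's inequality solved for the norm: [delta] is chosen so that (delta / e)^p = eta. Norm
    approximation thus becomes approximation in measure. *)
Lemma cnorm_small_set p (e eta : R) : (0 < p)%R -> (0 < e)%R -> (0 < eta)%R ->
  exists2 delta : R, (0 < delta)%R & forall f, cmeasurable f ->
    cnorm mu p%:E f <= delta%:E -> mu [set x | (e <= normc (f x))%R] <= eta%:E.
Proof.
move=> p0 e0 eta0; exists (e * eta `^ p^-1)%R; first by rewrite mulr_gt0// powR_gt0.
move=> f mf fd; have := cnorm_markov p0 e0 mf.
have ep : (0 < e `^ p)%R by rewrite powR_gt0.
rewrite -lee_pdivlMl// => /le_trans; apply.
rewrite lee_pdivrMl//; apply: (@le_trans _ _ ((e * eta `^ p^-1)%:E `^ p)).
  by rewrite lee_poweR_inv// lee_fin mulr_ge0// ?powR_ge0 ?ltW.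
rewrite poweR_EFin lee_fin powRM ?powR_ge0 ?(ltW e0)// -powRrM mulVf ?gt_eqF//.
by rewrite powRr1 ?(ltW eta0)// mulrC.
Qed.

Lemma measurable_normc_ge f (e : R) : cmeasurable f ->
  measurable [set x | (e <= normc (f x))%R].
Proof.
move=> mf; rewrite -[X in measurable X]setTI.
exact: measurable_fun_le measurableT (measurable_cst e) (measurable_normc mf).
Qed.

End Lp.
#[global] Hint Resolve cnorm_ge0 : core.

(** * The maximal inequality for one Dunford-Schwartz operator *)

Section AlmostEverywhere.
Context {d : measure_display} {Omega : measurableType d} {R : realType}.
Variable mu : {measure set Omega -> \bar R}.

(** The intersection of covers of measure at most 1/(j+1) is a null set containing [N]. *)
Lemma negligible_small_cover (N : set Omega) :
  (forall eta : R, 0 < eta -> exists Z, [/\ measurable Z, (mu Z <= eta%:E)%E & N `<=` Z]) ->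
  mu.-negligible N.
Proof.
move=> H.
have /choice[Z HZ] : forall j, exists Z,
    [/\ measurable Z, (mu Z <= (j.+1%:R^-1)%:E)%E & N `<=` Z].
  by move=> j; apply: H; rewrite invr_gt0.
exists (\bigcap_j Z j); split.
- by apply: bigcapT_measurable => j; case: (HZ j).
- apply/eqP; rewrite eq_le measure_ge0 andbT.
  apply/lee_addgt0Pr => e e0; rewrite add0e.
  have [j] : exists j, (j.+1%:R^-1 < e).
    exists (Num.truncn e^-1); rewrite invf_plt ?posrE//.
    exact: truncnS_gt.
  move=> je; apply: (@le_trans _ _ (mu (Z j))).
    apply: le_measure; rewrite ?inE; [|by case: (HZ j)|exact: bigcap_inf].
    by apply: bigcapT_measurable => k; case: (HZ k).
  by have [_ h _] := HZ j; rewrite (le_trans h)// lee_fin ltW.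
- by apply: sub_bigcap => j _; case: (HZ j).
Qed.

Lemma measure_le_ae (P Q : set Omega) : measurable P -> measurable Q ->
  (\forall x \ae mu, P x -> Q x) -> (mu P <= mu Q)%E.
Proof.
move=> mP mQ [N [mN N0 HN]].
apply: (@le_trans _ _ (mu (Q `|` N))).
  apply: le_measure; rewrite ?inE//; first exact: measurableU.
  move=> x Px; have [Qx|nQ] := pselect (Q x); [by left|right; apply: HN => /= h].
  by apply: nQ; exact: h.
by rewrite (le_trans (measureU2 _ _ _))// [X in (_ + X)%E](_ : _ = 0%E)// adde0.
Qed.

(** Passage to the limit in measure without extracting an almost everywhere convergent subsequence:
    the bad set [Z] may change with [e] and [eta], and only its measure matters. The fixed set [A]
    carries the points at which the bound is claimed. *)
Lemma ae_le_of_approx (A : set Omega) (w b : Omega -> R) :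
  (forall e eta : R, 0 < e -> 0 < eta -> exists Z, [/\ measurable Z, (mu Z <= eta%:E)%E &
     \forall x \ae mu, A x -> ~ Z x -> w x <= b x + e]) ->
  \forall x \ae mu, A x -> w x <= b x.
Proof.
move=> H.
suff : \forall x \ae mu, forall m : nat, A x -> w x <= b x + m.+1%:R^-1.
  apply: filterS => x Hx Ax; apply/ler_addgt0Pr => e e0.
  rewrite (le_trans (Hx (Num.truncn e^-1) Ax))// lerD2l ltW// invf_plt ?posrE//.
  exact: truncnS_gt.
apply: ae_foralln => m; apply: negligible_small_cover => eta eta0.
have [|Z [mZ Zeta [N [mN N0 HN]]]] := H (m.+1%:R^-1) _ _ eta0.
  by rewrite invr_gt0.
exists (Z `|` N); split; first exact: measurableU.
  rewrite (le_trans (measureU2 _ _ _))//.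
  by rewrite [X in (_ + X)%E](_ : _ = 0%E)// adde0.
move=> x /= nx; have [Zx|nZx] := pselect (Z x); [by left|right].
by apply: HN => /= h; apply: nx => Ax; exact: h.
Qed.

End AlmostEverywhere.

Section DunfordSchwartz.
Context {d : measure_display} {Omega : measurableType d} {R : realType}.
Variable mu : {measure set Omega -> \bar R}.
Variable S : (Omega -> R[i]) -> (Omega -> R[i]).
Hypothesis dsS : dunford_schwartz mu S.
Implicit Types (f g h : Omega -> R[i]) (a : R).

Lemma ds_L1 f : cLp mu 1 f -> cLp mu 1 (S f). Proof. by case: dsS => h _ _ _; exact: h. Qed.

Lemma ds_contract f : cLp mu 1 f -> (cnorm mu 1 (S f) <= cnorm mu 1 f)%E.
Proof. by case: dsS => _ _ h _; exact: h. Qed.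

Lemma ds_bound f a : cLp mu 1 f -> 0 <= a ->
  (\forall x \ae mu, normc (f x) <= a) -> \forall x \ae mu, normc (S f x) <= a.
Proof.
move=> Lf a0 fa; apply: le_cnormy; case: dsS => _ _ _ h.
apply: le_trans (cnormy_le a0 fa); apply: h => //.
exact: cLpy a0 (cLp_measurable Lf) fa.
Qed.

Lemma ds_sub f g : cLp mu 1 f -> cLp mu 1 g ->
  \forall x \ae mu, S (fun y => f y - g y) x = S f x - S g x.
Proof.
move=> Lf Lg; case: dsS => _ lin _ _.
have := lin (-1) g f Lg Lf.
rewrite (_ : (fun y => -1 * g y + f y) = (fun y => f y - g y)); last first.
  by apply/funext => y; rewrite mulN1r addrC.
by apply: filterS => x ->; rewrite mulN1r addrC.
Qed.

Lemma ds_scale (c : R[i]) f : cLp mu 1 f ->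
  \forall x \ae mu, S (fun y => c * f y) x = c * S f x.
Proof.
move=> Lf; case: dsS => _ lin _ _; have L0 := cLp0 mu (@ltr01 R).
(* Linearity with coefficient -1 at the zero function gives S 0 = - S 0 + S 0 = 0 almost
   everywhere. *)
have := lin c f _ Lf L0; have := lin (-1) _ _ L0 L0.
rewrite (_ : (fun y => -1 * 0 + 0) = fun=> 0); last first.
  by apply/funext => y; rewrite mulr0 addr0.
rewrite (_ : (fun y => c * f y + 0) = fun y => c * f y); last first.
  by apply/funext => y; rewrite addr0.
apply: filterS2 => x; rewrite mulN1r addNr => -> ->; by rewrite addr0.
Qed.

Lemma ds_add f g : cLp mu 1 f -> cLp mu 1 g ->
  \forall x \ae mu, S (fun y => f y + g y) x = S f x + S g x.
Proof.
move=> Lf Lg; case: dsS => _ lin _ _; have := lin 1 f g Lf Lg.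
under [X in S X]eq_fun do rewrite mul1r.
by apply: filterS => x ->; rewrite mul1r.
Qed.

Lemma ds_sum (F : nat -> Omega -> R[i]) n : (forall k, cLp mu 1 (F k)) ->
  \forall x \ae mu, S (fun y => \sum_(k < n) F k y) x = \sum_(k < n) S (F k) x.
Proof.
move=> LF; elim: n => [|n ih].
  have := ds_scale 0 (LF 0); under [X in S X]eq_fun do rewrite mul0r.
  rewrite (_ : (fun y => \sum_(k < 0) F k y) = (fun=> 0)); last first.
    by apply/funext => y; rewrite big_ord0.
  by apply: filterS => x ->; rewrite mul0r big_ord0.
have Ls : cLp mu 1 (fun y => \sum_(k < n) F k y) by apply: cLp_sum.
under [X in S X]eq_fun do rewrite big_ord_recr/=.
apply: filterS2 ih (ds_add Ls (LF n)) => x ih ->.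
by rewrite ih big_ord_recr.
Qed.

(** By contraction, S (f - g) has L^1 norm 0. This is how a map on representatives acts on
    classes. *)
Lemma ds_ae f g : cLp mu 1 f -> cLp mu 1 g -> (\forall x \ae mu, f x = g x) ->
  \forall x \ae mu, S f x = S g x.
Proof.
move=> Lf Lg fg; have Lfg := cLpB (lexx 1) Lf Lg.
have : \forall x \ae mu, S (fun y => f y - g y) x = 0.
  apply: (cnorm_eq0_ae ltr01); first exact: cLp_measurable (ds_L1 Lfg).
  apply/eqP; rewrite eq_le cnorm_ge0 andbT (le_trans (ds_contract Lfg))//.
  rewrite (_ : cnorm mu 1 _ = cnorm mu 1 (fun=> 0)) ?cnorm0//.
  rewrite -[RHS](cnorm0 mu (@ltr01 R)).
  apply: (eq_cnorm ltr01); [exact: cLp_measurable Lfg|exact: cmeasurable_cst|].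
  by apply: filterS fg => x ->; rewrite subrr.
by apply: filterS2 (ds_sub Lf Lg) => x -> /eqP; rewrite subr_eq0 => /eqP.
Qed.

Lemma ds_dist f g : cLp mu 1 f -> cLp mu 1 g ->
  (cdist mu 1 (S f) (S g) <= cdist mu 1 f g)%E.
Proof.
move=> Lf Lg; apply: le_trans (ds_contract (cLpB (lexx 1) Lf Lg)).
have LS := cLpB (lexx 1) (ds_L1 Lf) (ds_L1 Lg).
rewrite le_eqVlt; apply/orP; left; apply/eqP; apply: (eq_cnorm ltr01).
- exact: cLp_measurable LS.
- exact: cLp_measurable (ds_L1 (cLpB (lexx 1) Lf Lg)).
- by apply: filterS (ds_sub Lf Lg) => x ->.
Qed.

End DunfordSchwartz.

(* Chacon's filling scheme.  At stage [k] the function [(fill k).1] is the part of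
   the orbit of [f] not yet absorbed, and [(fill k).2 <= a] records how much has
   been absorbed at each point; absorbed pieces add up to a function bounded by [a]. *)
Section Filling.
Context {d : measure_display} {Omega : measurableType d} {R : realType}.
Variable mu : {measure set Omega -> \bar R}.
Variable S : (Omega -> R[i]) -> (Omega -> R[i]).
Hypothesis dsS : dunford_schwartz mu S.
Variables (f : Omega -> R[i]) (a : R).
Hypotheses (Lf : cLp mu 1 f) (a0 : 0 < a).

Let absorb (go : (Omega -> R[i]) * (Omega -> R)) := ctrunc (fun x => a - go.2 x) go.1.

Fixpoint fill (k : nat) : (Omega -> R[i]) * (Omega -> R) :=
  if k is k'.+1 then
    (S (fun x => (fill k').1 x - absorb (fill k') x),
     fun x => (fill k').2 x + normc (absorb (fill k') x))
  else (f, fun=> 0).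

Let g k := (fill k).1.
Let o k := (fill k).2.
Let h k := absorb (fill k).
Let r k x := g k x - h k x.

Let oS k x : o k.+1 x = o k x + normc (h k x). Proof. by []. Qed.
Let gS k : g k.+1 = S (r k). Proof. by []. Qed.

Lemma fill_bounds k x : 0 <= o k x <= a.
Proof.
elim: k => [|k /andP[lo up]]; first by rewrite lexx ltW.
rewrite oS addr_ge0 ?normc_ge0//= /h /absorb normc_ctrunc ?subr_ge0//.
by rewrite -lerBrDl ge_min lexx orbT.
Qed.

Let o_le_a k x : 0 <= a - o k x.
Proof. by rewrite subr_ge0; have /andP[] := fill_bounds k x. Qed.

Let normc_h k x : normc (h k x) = Num.min (normc (g k x)) (a - o k x).
Proof. exact: (@normc_ctrunc _ _ _ (fun x => a - o k x) _ _ (o_le_a k x)). Qed.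

Let normc_r k x : normc (r k x) = normc (g k x) - Num.min (normc (g k x)) (a - o k x).
Proof. exact: (@normc_sub_ctrunc _ _ _ (fun x => a - o k x) _ _ (o_le_a k x)). Qed.

Let fill_mble k : cLp mu 1 (g k) /\ measurable_fun setT (o k).
Proof.
elim: k => [|k [Lg mo]]; first by split => //; exact: measurable_cst.
have mh : cmeasurable (h k).
  apply: cmeasurable_ctrunc (cLp_measurable Lg); exact: measurable_funB.
have Lh : cLp mu 1 (h k).
  apply: le_cLp Lg _ => //; apply: nearW => x.
  by rewrite normc_h ge_min lexx.
split; first by rewrite gS; apply: (ds_L1 dsS); exact: cLpB.
by apply: measurable_funD => //; exact: measurable_normc.
Qed.

Let Lg k : cLp mu 1 (g k). Proof. by case: (fill_mble k). Qed.
Let mo k : measurable_fun setT (o k). Proof. by case: (fill_mble k). Qed.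
Let mh k : cmeasurable (h k).
Proof. apply: cmeasurable_ctrunc (cLp_measurable (Lg k)); exact: measurable_funB (measurable_cst a) (mo k). Qed.
Let Lh k : cLp mu 1 (h k).
Proof.
apply: le_cLp (Lg k) _ => //; apply: nearW => x.
by rewrite normc_h ge_min lexx.
Qed.
Let Lr k : cLp mu 1 (r k). Proof. exact: cLpB. Qed.

(** Mass balance: at each stage |g| = |r| + |h| pointwise, the mass of h moves into [o], and [S]
    does not increase the mass of r. *)
Lemma fill_mass k : (cnorm mu 1 (g k) + \int[mu]_x (o k x)%:E <= cnorm mu 1 f)%E.
Proof.
elim: k => [|k ih]; first by rewrite integral0 adde0.
apply: le_trans ih; rewrite gS.
under eq_integral do rewrite oS EFinD.
rewrite ge0_integralD//=; last 4 first.
- by move=> x _; rewrite lee_fin; case/andP: (fill_bounds k x).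
- exact/measurable_EFinP.
- by move=> x _; rewrite lee_fin normc_ge0.
- exact: measurable_normcE.
rewrite addeA (addeAC _ _ (\int[mu]_x _)%E) leeD2r//.
apply: (@le_trans _ _ (cnorm mu 1 (r k) + cnorm mu 1 (h k))%E).
  by rewrite (cnorm1E mu (h k)) leeD2r//; exact: (ds_contract dsS).
rewrite !cnorm1E -ge0_integralD//=; last 4 first.
- by move=> x _; rewrite lee_fin normc_ge0.
- exact: measurable_normcE (cLp_measurable (Lr k)).
- by move=> x _; rewrite lee_fin normc_ge0.
- exact: measurable_normcE.
rewrite le_eqVlt; apply/orP; left; apply/eqP; apply: eq_integral => x _.
by rewrite -EFinD normc_r normc_h subrK.
Qed.

Let o_nd x : {homo (fun k => o k x) : m n / (m <= n)%N >-> m <= n}.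
Proof. by apply/nondecreasing_seqP => k; rewrite oS lerDl normc_ge0. Qed.

Definition filled := \bigcup_k [set x | a <= o k x].

Lemma filled_measurable : measurable filled.
Proof.
apply: bigcupT_measurable => k; rewrite -[X in measurable X]setTI.
exact: measurable_fun_le measurableT (measurable_cst a) (mo k).
Qed.

(** At each stage this is Chebyshev's inequality for [o k], whose integral is bounded by the mass
    balance; the stages increase to [filled]. *)
Lemma filled_measure : (a%:E * mu filled <= cnorm mu 1 f)%E.
Proof.
have mE k : measurable [set x | a <= o k x].
  by rewrite -[X in measurable X]setTI; exact: measurable_fun_le measurableT (measurable_cst a) (mo k).
have := @nondecreasing_cvg_mu _ _ _ mu (fun k => [set x | a <= o k x]) mE
  filled_measurable.
have nd : nondecreasing_seq (fun k => [set x | a <= o k x]).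
  move=> m n mn; apply/subsetPset => x /= /le_trans; apply; exact: o_nd.
move=> /(_ nd) cv.
have {cv}cv : (a%:E * mu [set x | (a <= o k x)%R])%E @[k --> \oo] --> (a%:E * mu filled)%E.
  by apply: cvgeZl => //; exact: cv.
rewrite -(cvg_lim _ cv)//; apply: lime_le; first by apply/cvg_ex; eexists; exact: cv.
apply: nearW => k; apply: le_trans (fill_mass k).
apply: (@le_trans _ _ (\int[mu]_x (o k x)%:E)%E); last by rewrite -[leLHS]add0e leeD2r ?cnorm_ge0.
rewrite -integral_cst//.
rewrite integral_mkcond; apply: ge0_le_integral => //.
- by move=> x _; rewrite /patch; case: ifP => // _; rewrite lee_fin ltW.
- apply/(measurable_restrictT _ (mE k)); exact: measurable_cst.
- exact/measurable_EFinP.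
- move=> x _; rewrite /patch; case: ifPn => [|_]; first by rewrite inE/= lee_fin.
  by rewrite lee_fin; case/andP: (fill_bounds k x).
Qed.

(** If some of g were left over, the absorption would have used up the whole remaining capacity a -
    o, and the point would be full at stage k + 1. *)
Let r_filled k x : ~ filled x -> r k x = 0.
Proof.
move=> nx; apply: eq0_normc; rewrite normc_r.
rewrite min_l ?subrr//; rewrite leNgt; apply/negP => lt; apply: nx.
suff E : a <= o k.+1 x by exists k.+1.
by rewrite oS normc_h min_r ?(ltW lt)// subrKC.
Qed.

Lemma iter_L1 k : cLp mu 1 (iter k S f).
Proof. by elim: k => // k ih; exact: (ds_L1 dsS). Qed.

Let defect n x := \sum_(k < n) (iter k S f x - r k x).

(** Put d_k = S^k f - r_k. Since g_(k+1) = S r_k and r = g - h, one has d_(k+1) = S d_k + h_(k+1),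
    with d_0 = h_0. Summing over k gives the recursion. *)
Let defectS n : \forall x \ae mu,
  defect n.+1 x = S (defect n) x + \sum_(k < n.+1) h k x.
Proof.
have Ld k : cLp mu 1 (fun x => iter k S f x - r k x) by apply: cLpB => //; exact: iter_L1.
have H2 : \forall x \ae mu, forall k,
    S (fun y => iter k S f y - r k y) x = S (iter k S f) x - S (r k) x.
  by apply: ae_foralln => k; apply: (ds_sub dsS) => //; exact: iter_L1.
apply: filterS2 (ds_sum dsS n Ld) H2 => x H1 H2x.
rewrite /defect H1 big_ord_recl/= [X in _ = _ + X]big_ord_recl/=.
rewrite {1}/r /= opprB addrCA subrr addr0 addrCA; congr (_ + _).
rewrite -big_split/=; apply: eq_bigr => k _.
by rewrite H2x /bump/= !add1n {1}/r gS opprB addrA [in RHS]addrAC.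
Qed.

(** In the recursion [S] contracts the sup norm, and the absorbed pieces total at most the capacity
    [a], so each step costs [a]. *)
Let defect_bound n : \forall x \ae mu, normc (defect n x) <= n%:R * a.
Proof.
have Ld k : cLp mu 1 (fun x => iter k S f x - r k x) by apply: cLpB => //; exact: iter_L1.
have LD : cLp mu 1 (defect n) by apply: cLp_sum.
elim: n LD => [|n ih] LD.
  by apply: nearW => x; rewrite /defect big_ord0 normc0 mul0r.
have LDn : cLp mu 1 (defect n) by apply: cLp_sum.
have := ds_bound dsS LDn (mulr_ge0 (ler0n _ n) (ltW a0)) (ih LDn).
apply: filterS2 (defectS n) => x -> b.
rewrite (le_trans (normcD _ _))// -natr1 mulrDl mul1r lerD//.
rewrite (le_trans (normc_sum _ _))//.
rewrite (_ : \sum_(k < n.+1) normc (h k x) = o n.+1 x).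
  by case/andP: (fill_bounds n.+1 x).
elim: n.+1 => [|m ihm]; first by rewrite big_ord0.
by rewrite big_ord_recr/= ihm.
Qed.

(** Off [filled] every remainder r_k vanishes, so the defect is the whole ergodic sum. *)
Lemma filled_maximal n : \forall x \ae mu, ~ filled x ->
  normc (\sum_(k < n) iter k S f x) <= n%:R * a.
Proof.
apply: filterS (defect_bound n) => x; rewrite /defect => b nx.
by move: b; under eq_bigr do rewrite r_filled// subr0.
Qed.

End Filling.

(** * Interpolation between [L^1] and [L^oo] *)

Section PowerByHinges.
Context {R : realType}.
Variables (p delta : R).
Hypotheses (p1 : 1 <= p) (delta0 : 0 < delta).
Implicit Types (u : R) (K : nat).

Let b (k : nat) : R := delta * 2 ^+ k.

(* Abel summation at the dyadic nodes [b k]: the coefficients add up to [b K `^ (p - 1)],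
   which makes [hinge_sum] comparable to [u `^ p]. *)
Definition hinge_coef (k : nat) : R :=
  if k is k'.+1 then b k `^ (p - 1) - b k' `^ (p - 1) else b 0 `^ (p - 1).

Definition hinge_sum K u := \sum_(k < K.+1) hinge_coef k * (u - Num.min u (delta * 2 ^+ k)).

Let b_gt0 k : 0 < b k. Proof. by rewrite mulr_gt0// exprn_gt0. Qed.

Let b_le k : b k <= b k.+1.
Proof. by rewrite ler_pM2l// ler_eXn2l ?ltr1n. Qed.

Let p10 : 0 <= p - 1. Proof. by rewrite subr_ge0. Qed.

Lemma hinge_coef_ge0 k : 0 <= hinge_coef k.
Proof.
case: k => [|k] /=; first exact: powR_ge0.
by rewrite subr_ge0 ge0_ler_powR// ?nnegrE ltW.
Qed.

Let sum_coef K : \sum_(k < K.+1) hinge_coef k = b K `^ (p - 1).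
Proof.
elim: K => [|K ih]; first by rewrite big_ord_recr big_ord0/= add0r.
by rewrite big_ord_recr/= ih subrKC.
Qed.

(** Each hinge is the positive part (u - b_k)^+. While u is below the last node, the last hinge is 0
    and induction applies. Above it every hinge is at most u, and the coefficients telescope to
    b_K^(p-1), which is at most u^(p-1). *)
Lemma hinge_sum_le K u : 0 <= u -> hinge_sum K u <= u `^ p.
Proof.
move=> u0; elim: K => [|K ih].
  rewrite /hinge_sum big_ord_recr big_ord0/= add0r -[delta * _]/(b 0).
  have [ub|bu] := leP u (b 0); first by rewrite subrr mulr0 powR_ge0.
  have u1 : 0 < u by rewrite (lt_trans (b_gt0 0)).
  rewrite -(mulr_powRB1 u0 (lt_le_trans ltr01 p1)) mulrC ler_pM ?powR_ge0//.
  - by rewrite subr_ge0 ltW.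
  - by rewrite gerBl ltW.
  - by rewrite ge0_ler_powR// ?nnegrE ltW.
have [ub|bu] := leP u (b K.+1).
  by rewrite /hinge_sum big_ord_recr/= (min_l ub) subrr mulr0 addr0.
rewrite -(mulr_powRB1 u0 (lt_le_trans ltr01 p1)) mulrC.
apply: (@le_trans _ _ (b K.+1 `^ (p - 1) * u)); last first.
  by rewrite ler_wpM2r// ge0_ler_powR// ?nnegrE ltW.
rewrite -sum_coef mulr_suml; apply: ler_sum => k _.
by rewrite ler_wpM2l ?hinge_coef_ge0// gerBl le_min u0 (ltW (b_gt0 k)).
Qed.

(** If 2 b_m <= u <= 4 b_m, all hinges up to m are at least u - b_m >= u/2, and their coefficients
    total b_m^(p-1) >= (u/4)^(p-1); hence the constant. The nodes double, so these windows cover the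
    range, and further hinges only increase the sum. *)
Lemma hinge_sum_ge K u : 2 * delta <= u -> u <= 4 * (delta * 2 ^+ K) ->
  u `^ p <= 2 * 4 `^ (p - 1) * hinge_sum K u.
Proof.
move=> du; have u0 : 0 < u by rewrite (lt_le_trans _ du)// mulr_gt0.
have hit m : 2 * b m <= u -> u <= 4 * b m ->
    u `^ p <= 2 * 4 `^ (p - 1) * hinge_sum m u.
  move=> lo up; have bm0 := b_gt0 m.
  apply: (@le_trans _ _ (2 * 4 `^ (p - 1) * (b m `^ (p - 1) * (u - b m)))).
    rewrite [leRHS](_ : _ = 2 * (u - b m) * (4 * b m) `^ (p - 1)); last first.
      by rewrite powRM ?(ltW bm0)//; ring.
    rewrite -(mulr_powRB1 (ltW u0) (lt_le_trans ltr01 p1)).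
    rewrite ler_pM ?powR_ge0 ?(ltW u0)//; first by lra.
    by rewrite ge0_ler_powR// ?nnegrE ?(ltW u0)// mulr_ge0// ltW.
  rewrite ler_wpM2l ?mulr_ge0 ?powR_ge0// -sum_coef mulr_suml; apply: ler_sum => k _.
  rewrite ler_wpM2l ?hinge_coef_ge0// lerD2l lerN2 ge_min; apply/orP; right.
  by rewrite ler_pM2l// ler_eXn2l ?ltr1n// -ltnS.
elim: K => [|K ih] ud; first by apply: hit => //; rewrite /b expr0 mulr1.
have [bu|ub] := leP (2 * b K.+1) u; first exact: hit.
apply: (le_trans (ih _)).
  by rewrite (le_trans (ltW ub))// /b exprS; lra.
rewrite ler_wpM2l ?mulr_ge0 ?powR_ge0// /hinge_sum [leRHS]big_ord_recr/= lerDl.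
rewrite mulr_ge0 ?(hinge_coef_ge0 K.+1)//.
by rewrite subr_ge0 ge_min lexx.
Qed.

End PowerByHinges.

Section WeakTypeInterpolation.
Context {d : measure_display} {Omega : measurableType d} {R : realType}.
Variable mu : {measure set Omega -> \bar R}.
Local Open Scope ereal_scope.

(* Real interpolation between L^1 and L^oo: the hypothesis holds for
   [psi = |S f|] and [phi = |f|] when [S] contracts both endpoint norms. *)
Lemma integral_powR_le_of_hinges (p : R) (psi phi : Omega -> R) : (1 <= p)%R ->
  measurable_fun setT psi -> measurable_fun setT phi ->
  (forall x, 0 <= psi x)%R -> (forall x, 0 <= phi x)%R ->
  (forall a : R, (0 < a)%R ->
     \int[mu]_x (psi x - Num.min (psi x) a)%:E <= \int[mu]_x (phi x - Num.min (phi x) a)%:E) ->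
  \int[mu]_x (psi x `^ p)%:E <= (2 * 4 `^ (p - 1))%:E * \int[mu]_x (phi x `^ p)%:E.
Proof.
move=> p1 mpsi mphi psi0 phi0 H.
have p0 : (0 < p)%R by rewrite (lt_le_trans _ p1).
have mpow (u : Omega -> R) : measurable_fun setT u -> measurable_fun setT (fun x : Omega => (u x `^ p)%R).
  by move=> mu'; apply: (@measurableT_comp _ _ _ _ _ _ (@powR R ^~ p)).
have mhinge (u : Omega -> R) (a : R) : measurable_fun setT u ->
    measurable_fun setT (fun x : Omega => (u x - Num.min (u x) a)%R).
  by move=> mu'; apply: measurable_funB => //; apply: measurable_minr.
pose del n : R := (2^-1 ^+ n)%R.
have del0 n : (0 < del n)%R by rewrite exprn_gt0// invr_gt0.
(* The window where the lower hinge bound applies with 2n + 1 nodes starting at 2^-n. Its ends are 2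
   * 2^-n and 4 * 2^n, so the windows increase to the set where [psi] is positive. *)
pose A n : set Omega := [set x | (2 * del n <= psi x)%R] `&` [set x | (psi x <= 4 * (del n * 2 ^+ (n + n)))%R].
have mA n : measurable (A n).
  apply: measurableI; rewrite -[X in measurable X]setTI.
    exact: (measurable_fun_le measurableT (measurable_cst _) mpsi).
  exact: (measurable_fun_le measurableT mpsi (measurable_cst _)).
have delE n : (del n * 2 ^+ (n + n) = 2 ^+ n)%R.
  by rewrite exprD mulrA /del -exprMn mulVf// expr1n mul1r.
pose F n x := (psi x `^ p * \1_(A n) x)%:E.
have mF n : measurable_fun setT (F n).
  by apply/measurable_EFinP; apply: measurable_funM; [exact: mpow|exact: measurable_indic].
have F0 n x : 0 <= F n x by rewrite lee_fin mulr_ge0// powR_ge0.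
have AS n : A n `<=` A n.+1.
  move=> x [lo up]; split => /=.
    apply: le_trans lo; rewrite ler_pM2l// /del exprS.
    by rewrite ler_piMl ?exprn_ge0 ?invr_ge0// invf_le1// ler1n.
  apply: (le_trans up); rewrite !delE ler_pM2l//.
  by rewrite ler_eXn2l// ltr1n.
have ndF x : setT x -> {homo (F ^~ x) : m n / (m <= n)%N >-> m <= n}.
  move=> _; apply/nondecreasing_seqP => n; rewrite lee_fin ler_wpM2l ?powR_ge0//.
  rewrite !indicE ler_nat; have [xA|] := boolP (x \in A n) => //.
  by rewrite mem_set//; apply: AS; rewrite inE in xA.
have cvF x : F n x @[n --> \oo] --> (psi x `^ p)%:E.
  apply/cvg_EFin; first exact: nearW.
  apply: cvg_near_cst.
  have [psix|psix] := eqVneq (psi x) 0%R.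
    by apply: nearW => n; rewrite /= psix powR0 ?gt_eqF// mul0r.
  have px : (0 < psi x)%R by rewrite lt0r psix psi0.
  near=> n; rewrite /= indicE mem_set ?mulr1//; split => /=.
    rewrite mulrC -ler_pdivlMr//; near: n.
    have cvd : del n @[n --> \oo] --> (0%R : R).
      by apply: cvg_expr; rewrite ger0_norm ?invr_ge0// invf_lt1// ltr1n.
    by apply: (cvgr_le _ cvd); rewrite divr_gt0.
  rewrite delE (@le_trans _ _ (2 ^+ n)%R)//; last by rewrite ler_peMl ?exprn_ge0// ler1n.
  apply: (@le_trans _ _ n%:R); last by rewrite -natrX ler_nat ltnW// ltn_expl.
  by near: n; exact: nbhs_infty_ger.
have cvI := @cvg_monotone_convergence _ _ _ mu _ measurableT _ mF (fun n x _ => F0 n x) ndF.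
have -> : \int[mu]_x (psi x `^ p)%:E = \int[mu]_x (limn (F^~ x)).
  by apply: eq_integral => x _; apply/esym/cvg_lim => //; exact: cvF.
rewrite -(cvg_lim _ cvI)//; apply: lime_le; first by apply/cvg_ex; eexists; exact: cvI.
apply: nearW => n.
pose C : R := (2 * 4 `^ (p - 1))%R.
have C0 : (0 <= C)%R by rewrite mulr_ge0// powR_ge0.
have coef0 k : (0 <= C * hinge_coef p (del n) k)%R by rewrite mulr_ge0// hinge_coef_ge0.
have node0 k : (0 < del n * 2 ^+ k)%R by rewrite mulr_gt0// exprn_gt0.
have hinge_ge0 (u : Omega -> R) a x : 0 <= (u x - Num.min (u x) a)%:E.
  by rewrite lee_fin subr_ge0 ge_min lexx.
have hingeE (u : Omega -> R) : measurable_fun setT u ->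
    \int[mu]_x (C * hinge_sum p (del n) (n + n) (u x))%:E =
    \sum_(k < (n + n).+1) (C * hinge_coef p (del n) k)%:E *
       \int[mu]_x (u x - Num.min (u x) (del n * 2 ^+ k))%:E.
  move=> mu'; under eq_integral do rewrite /hinge_sum mulr_sumr -sumEFin.
  rewrite ge0_integral_sum//; last 2 first.
  - move=> k; apply/measurable_EFinP; do 2 apply: measurable_funM => //.
    exact: mhinge.
  - by move=> k x _; rewrite mulrA EFinM mule_ge0// lee_fin.
  apply: eq_bigr => k _; under eq_integral do rewrite mulrA EFinM.
  by rewrite ge0_integralZl_EFin//; apply/measurable_EFinP; exact: mhinge.
have mhs (u : Omega -> R) : measurable_fun setT u ->
    measurable_fun setT (fun x => (C * hinge_sum p (del n) (n + n) (u x))%:E).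
  move=> mu'; apply/measurable_EFinP; apply: measurable_funM => //.
  apply: measurable_sum => k; apply: measurable_funM => //; exact: mhinge.
(* The power of [psi] is bounded by its hinges on [A n], the hypothesis is applied at each node, and
   the hinges of [phi] are bounded by its power. *)
apply: (@le_trans _ _ (\int[mu]_x (C * hinge_sum p (del n) (n + n) (psi x))%:E)).
  apply: ge0_le_integral => //; first exact: mhs.
  move=> x _; rewrite lee_fin indicE.
  have [|_] := boolP (x \in A n).
    by rewrite inE mulr1 => -[lo up]; exact: hinge_sum_ge.
  rewrite mulr0 mulr_ge0// sumr_ge0// => k _.
  by rewrite mulr_ge0 ?hinge_coef_ge0//; have := hinge_ge0 psi (del n * 2 ^+ k)%R x; rewrite lee_fin.
rewrite hingeE//; apply: (@le_trans _ _ (\int[mu]_x (C * hinge_sum p (del n) (n + n) (phi x))%:E)).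
  by rewrite hingeE//; apply: lee_sum => k _; rewrite lee_wpmul2l ?lee_fin//; exact: H.
rewrite -ge0_integralZl_EFin//; last 2 first.
- by move=> x _; rewrite lee_fin powR_ge0.
- by apply/measurable_EFinP; exact: mpow.
apply: ge0_le_integral => //.
- move=> x _; rewrite lee_fin mulr_ge0// sumr_ge0// => k _.
  by rewrite mulr_ge0 ?hinge_coef_ge0//; have := hinge_ge0 phi (del n * 2 ^+ k)%R x; rewrite lee_fin.
- exact: mhs.
- by apply/measurable_EFinP; apply: measurable_funM => //; exact: mpow.
- by move=> x _; rewrite -EFinM lee_fin ler_wpM2l// hinge_sum_le.
Unshelve. all: by end_near. Qed.

End WeakTypeInterpolation.

(** * Truncation and density in L^p *)

Section LpDecomposition.
Context {d : measure_display} {Omega : measurableType d} {R : realType}.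
Variable mu : {measure set Omega -> \bar R}.
Implicit Types (f g h : Omega -> R[i]).

(** Away from 0 an L^p function is integrable: (m u)^(p-1) >= 1. It is used with m = 1/a where |f| >
    a, and with m = n + 1 where |f| >= 1/(n+1). *)
Lemma le_powR_of_ge (p m u : R) : 1 <= p -> 0 < m -> 1 <= m * u ->
  u <= m `^ (p - 1) * u `^ p.
Proof.
move=> p1 m0 mu1; have p0 : 0 < p by rewrite (lt_le_trans _ p1).
have u0 : 0 <= u by rewrite -(pmulr_rge0 _ m0) (le_trans _ mu1).
rewrite -(mulr_powRB1 u0 p0) mulrCA -powRM// ?(ltW m0)// ler_peMr//.
have e1 : (1 : R) `^ (p - 1) = 1 by rewrite powR1.
by rewrite -[leLHS]e1 ge0_ler_powR ?subr_ge0// nnegrE// mulr_ge0// ltW.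
Qed.

Lemma cLp1_of_powR (p C : R) f h : 0 < p -> cmeasurable h -> cLp mu p%:E f ->
  0 <= C -> (forall x, normc (h x) <= C * normc (f x) `^ p) -> cLp mu 1 h.
Proof.
move=> p0 mh [mf f1] C0 hf; split => //; rewrite cnorm1E.
apply: (@le_lt_trans _ _ (\int[mu]_x (C%:E * (normc (f x) `^ p)%:E)%E)%E).
  apply: ge0_le_integral => //.
  - by move=> x _; rewrite lee_fin normc_ge0.
  - exact: measurable_normcE.
  - by apply: measurable_funeM; exact: measurable_normc_powR.
  - by move=> x _; rewrite -EFinM lee_fin.
rewrite ge0_integralZl//; last 2 first.
- exact: measurable_normc_powR.
- by move=> x _; rewrite lee_fin powR_ge0.
by rewrite lte_mul_pinfty// -cnorm_poweR// poweR_lty.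
Qed.

Lemma cLp_sub_ctrunc (p a : R) f : 1 <= p -> 0 < a -> cLp mu p%:E f ->
  cLp mu 1 (fun x => f x - ctrunc (fun=> a) f x).
Proof.
move=> p1 a0 Lf; have mf := cLp_measurable Lf.
apply: (@cLp1_of_powR p (a^-1 `^ (p - 1)) f) => //.
- by rewrite (lt_le_trans _ p1).
- by apply: cmeasurableB => //; apply: cmeasurable_ctrunc.
- exact: powR_ge0.
move=> x; rewrite normc_sub_ctrunc ?(ltW a0)//.
have [fa|af] := leP (normc (f x)) a; first by rewrite subrr mulr_ge0 ?powR_ge0.
rewrite (@le_trans _ _ (normc (f x)))//; first by rewrite gerBl ltW.
by apply: le_powR_of_ge; rewrite ?invr_gt0// ler_pdivlMl// mulr1 ltW.
Qed.

Lemma cLp_dense (p eta : R) f : 1 <= p -> 0 < eta -> cLp mu p%:E f ->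
  exists h (c : R), [/\ 0 <= c, cLp mu 1 h, cLp mu p%:E h,
    forall x, normc (h x) <= c & (cdist mu p%:E f h <= eta%:E)%E].
Proof.
move=> p1 eta0 Lf; have [mf f1] := Lf.
have p0 : 0 < p by rewrite (lt_le_trans _ p1).
(* The lower bound makes the cut-off function integrable, the upper one makes it bounded. *)
pose B n : set Omega := [set x | n.+1%:R^-1 <= normc (f x)] `&` [set x | normc (f x) <= n.+1%:R].
have mB n : measurable (B n).
  apply: measurableI; rewrite -[X in measurable X]setTI.
    exact: (measurable_fun_le measurableT (measurable_cst _) (measurable_normc mf)).
  exact: (measurable_fun_le measurableT (measurable_normc mf) (measurable_cst _)).
pose h n x := (\1_(B n) x : R)%:C * f x.
have mh n : cmeasurable (h n).
  by apply: cmeasurableM => //; apply: cmeasurable_real; exact: measurable_indic.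
have hE n x : normc (h n x) = \1_(B n) x * normc (f x).
  by rewrite normcM normcR ger0_norm// indicE.
have hf n x : normc (h n x) <= normc (f x).
  by rewrite hE ler_piMl ?normc_ge0// indicE lern1 leq_b1.
have hc n x : normc (h n x) <= n.+1%:R.
  rewrite hE indicE; have [|_] := boolP (x \in B n); last by rewrite mul0r.
  by rewrite inE mul1r => -[].
have cvD : (\int[mu]_x (normc (f x - h n x) `^ p)%:E)%E @[n --> \oo] --> 0%E.
  rewrite -[X in _ --> X](@integral0 _ _ _ mu setT).
  apply: (@dominated_cvg _ _ _ mu _ measurableT _ _ (fun x => (normc (f x) `^ p)%:E)) => //.
  - by move=> n; apply: measurable_normc_powR; exact: cmeasurableB.
  - move=> x _; apply: cvg_near_cst.
    have [f0|f0] := eqVneq (normc (f x)) 0.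
      apply: nearW => n; rewrite /h (eq0_normc f0) mulr0 subrr.
      by rewrite normc0 powR0 ?gt_eqF.
    have fp : 0 < normc (f x) by rewrite lt0r f0 normc_ge0.
    near=> n; suff xB : B n x by rewrite /h indicE mem_set// mul1r subrr normc0 powR0 ?gt_eqF.
    split => /=.
      rewrite invf_ple ?posrE// (@le_trans _ _ n%:R) ?ler_nat//.
      by near: n; exact: nbhs_infty_ger.
    by rewrite (@le_trans _ _ n%:R) ?ler_nat//; near: n; exact: nbhs_infty_ger.
  - apply/integrableP; split; first exact: measurable_normc_powR.
    under eq_integral do rewrite gee0_abs ?lee_fin ?powR_ge0//.
    by rewrite -cnorm_poweR// poweR_lty.
  - move=> n x _; rewrite gee0_abs ?lee_fin ?powR_ge0// ge0_ler_powR ?nnegrE ?normc_ge0 ?(ltW p0)//.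
    rewrite /h indicE; have [_|_] := boolP (x \in B n); last by rewrite mul0r subr0.
    by rewrite mul1r subrr normc0 normc_ge0.
have [n hn] : exists n, (\int[mu]_x (normc (f x - h n x) `^ p)%:E <= (eta `^ p)%:E)%E.
  have int0 n : (0 <= \int[mu]_x (normc (f x - h n x) `^ p)%:E)%E.
    by apply: integral_ge0 => x _; rewrite lee_fin powR_ge0.
  have [N _ HN] := (ge0_cvge0P int0).1 cvD _ (powR_gt0 p eta0).
  by exists N; apply: HN => /=.
exists (h n), n.+1%:R; split => //.
- apply: (@cLp1_of_powR p (n.+1%:R `^ (p - 1)) f) => //.
  move=> x; rewrite hE indicE; have [|_] := boolP (x \in B n).
    rewrite inE mul1r => -[/= lo _]; apply: le_powR_of_ge => //.
    by rewrite -ler_pdivrMl// mulr1.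
  by rewrite mul0r mulr_ge0 ?powR_ge0.
- by apply: le_cLp Lf _ => //; apply: nearW.
- by rewrite -(lee_poweR_inv p0) ?lee_fin ?(ltW eta0) ?cnorm_ge0// cnorm_poweR.
Unshelve. all: by end_near. Qed.

(** Pointwise |f|^p <= c^(p-1) |f|. It turns L^1 continuity of the orbit of a bounded function into
    L^p continuity. *)
Lemma interpolation_L1_Loo (p c : R) f : 1 <= p -> 0 <= c -> cmeasurable f ->
  (\forall x \ae mu, normc (f x) <= c) ->
  (cnorm mu p%:E f `^ p <= (c `^ (p - 1))%:E * cnorm mu 1 f)%E.
Proof.
move=> p1 c0 mf fc; have p0 : 0 < p by rewrite (lt_le_trans _ p1).
rewrite cnorm_poweR// cnorm1E -ge0_integralZl//; last 3 first.
- exact: measurable_normcE.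
- by move=> x _; rewrite lee_fin normc_ge0.
- by rewrite lee_fin powR_ge0.
apply: ae_ge0_le_integral => //.
- by move=> x _; rewrite lee_fin powR_ge0.
- exact: measurable_normc_powR.
- by move=> x _; rewrite mule_ge0 ?lee_fin ?powR_ge0 ?normc_ge0.
- by apply: measurable_funeM; exact: measurable_normcE.
apply: filterS fc => x fc _; rewrite -EFinM lee_fin -(mulr_powRB1 (normc_ge0 _) p0) mulrC.
by rewrite ler_wpM2r ?normc_ge0// ge0_ler_powR ?subr_ge0// nnegrE ?normc_ge0.
Qed.

Lemma cLp_L1_plus_Loo (p : R) f : 1 <= p -> cLp mu p%:E f -> L1_plus_Loo mu f.
Proof.
move=> p1 Lf; exists (fun x => f x - ctrunc (fun=> 1) f x), (ctrunc (fun=> 1) f); split.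
- exact: (cLp_sub_ctrunc p1).
- apply: (@cLpy _ _ _ _ _ 1) => //.
    by apply: cmeasurable_ctrunc => //; exact: cLp_measurable Lf.
  by apply: nearW => x; rewrite normc_ctrunc// ge_min lexx orbT.
- by apply/funext => x; rewrite subrK.
Qed.

Lemma L1_plus_Loo_measurable f : L1_plus_Loo mu f -> cmeasurable f.
Proof. by move=> [g [h [[mg _] [mh _] ->]]]; exact: cmeasurableD. Qed.

Lemma L1_sub_L1_plus_Loo f : cLp mu 1 f -> L1_plus_Loo mu f.
Proof. exact: cLp_L1_plus_Loo. Qed.

Lemma Loo_sub_L1_plus_Loo f : cLp mu +oo f -> L1_plus_Loo mu f.
Proof.
move=> Lf; exists (fun=> 0), f; split => //; first exact: cLp0.
by apply/funext => x; rewrite add0r.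
Qed.

End LpDecomposition.

(** * Boundedness of the extensions on L^p *)

Section Extension.
Context {d : measure_display} {Omega : measurableType d} {R : realType}.
Variable mu : {measure set Omega -> \bar R}.
Variables T S : (Omega -> R[i]) -> (Omega -> R[i]).
Hypotheses (dsT : dunford_schwartz mu T) (extS : ds_extension mu T S).
Implicit Types (f g h : Omega -> R[i]).

Lemma ext_L1 f : cLp mu 1 f -> \forall x \ae mu, S f x = T f x.
Proof. by case: extS => _ _ h _ _; exact: h. Qed.

Lemma ext_add f g : L1_plus_Loo mu f -> L1_plus_Loo mu g ->
  \forall x \ae mu, S (fun y => f y + g y) x = S f x + S g x.
Proof.
move=> Lf Lg; case: extS => _ lin _ _ _; have := lin 1 f g Lf Lg.
under [X in S X]eq_fun do rewrite mul1r.
by apply: filterS => x ->; rewrite mul1r.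
Qed.

Lemma ext_bound f (a : R) : cmeasurable f -> 0 <= a ->
  (\forall x \ae mu, normc (f x) <= a) -> \forall x \ae mu, normc (S f x) <= a.
Proof.
move=> mf a0 fa; apply: le_cnormy; case: extS => _ _ _ h _.
by apply: le_trans (cnormy_le a0 fa); apply: h; exact: cLpy a0 mf fa.
Qed.

Lemma ext_mble (p : R) f : 1 <= p -> cLp mu p%:E f -> cmeasurable (S f).
Proof.
move=> p1 Lf; case: extS => h _ _ _ _.
by apply: (@L1_plus_Loo_measurable _ _ _ mu); apply: h; exact: cLp_L1_plus_Loo Lf.
Qed.

(** The p-th root of the constant in the hinge comparison. The sharp value would be 1; what matters
    below is a bound uniform along the semigroup. *)
Definition ext_const (p : R) : R := (2 * 4 `^ (p - 1)) `^ p^-1.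

Lemma ext_const_ge0 (p : R) : 0 <= ext_const p. Proof. exact: powR_ge0. Qed.

(** Cut f = f1 + f2 radially at level a. As |S f2| <= a, the excess (|S f| - a)^+ is at most |S f1|,
    whose integral is at most that of |f1| = (|f| - a)^+. The hinge comparison turns this into a
    bound on p-th powers. *)
Lemma ext_Lp_bound (p : R) f : 1 <= p -> cLp mu p%:E f ->
  (cnorm mu p%:E (S f) <= (ext_const p)%:E * cnorm mu p%:E f)%E.
Proof.
move=> p1 Lf; have p0 : 0 < p by rewrite (lt_le_trans _ p1).
have mf := cLp_measurable Lf; have mS := ext_mble p1 Lf.
rewrite -(lee_poweR_inv p0) ?mule_ge0 ?cnorm_ge0 ?lee_fin ?ext_const_ge0//.
rewrite poweRM ?lee_fin ?ext_const_ge0// !cnorm_poweR// poweR_EFin -powRrM mulVf ?gt_eqF//.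
rewrite powRr1 ?mulr_ge0 ?powR_ge0//.
apply: integral_powR_le_of_hinges => //; try exact: measurable_normc;
  try by move=> x; exact: normc_ge0.
move=> a a0; pose f2 := ctrunc (fun=> a) f; pose f1 x := f x - f2 x.
have Lf1 : cLp mu 1 f1 := cLp_sub_ctrunc p1 a0 Lf.
have mf2 : cmeasurable f2 by exact: cmeasurable_ctrunc.
have f2a x : normc (f2 x) <= a by rewrite normc_ctrunc ?(ltW a0)// ge_min lexx orbT.
have Sf2 : \forall x \ae mu, normc (S f2 x) <= a.
  by apply: (ext_bound mf2 (ltW a0)); exact: nearW.
have Lf2 : L1_plus_Loo mu f2.
  by apply: Loo_sub_L1_plus_Loo; apply: (cLpy (ltW a0) mf2); exact: nearW.
have Sf := ext_add (L1_sub_L1_plus_Loo Lf1) Lf2.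
have ef : (fun y => f1 y + f2 y) = f by apply/funext => y; rewrite /f1 subrK.
rewrite ef in Sf.
rewrite [leRHS](_ : _ = \int[mu]_x (normc (f1 x))%:E)%E; last first.
  by apply: eq_integral => x _; rewrite /f1 /f2 normc_sub_ctrunc ?(ltW a0).
rewrite -cnorm1E; apply: le_trans (ds_contract dsT Lf1); rewrite cnorm1E.
apply: ae_ge0_le_integral => //.
- by move=> x _; rewrite lee_fin subr_ge0 ge_min lexx.
- apply/measurable_EFinP; apply: measurable_funB; first exact: measurable_normc.
  by apply: measurable_minr => //; exact: measurable_normc.
- by move=> x _; rewrite lee_fin normc_ge0.
- exact: measurable_normcE (cLp_measurable (ds_L1 dsT Lf1)).
apply: filterS3 Sf Sf2 (ext_L1 Lf1) => x -> h2 h1 _; rewrite lee_fin -h1.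
have := normcD (S f1 x) (S f2 x); have := normc_ge0 (S f1 x).
by case: (leP (normc (S f1 x + S f2 x)) a) => ? ? ?; lra.
Qed.

Lemma ext_Lp (p : R) f : 1 <= p -> cLp mu p%:E f -> cLp mu p%:E (S f).
Proof.
move=> p1 Lf; split; first exact: ext_mble Lf.
rewrite (le_lt_trans (ext_Lp_bound p1 Lf))// lte_mul_pinfty ?lee_fin ?ext_const_ge0//.
by case: Lf.
Qed.

Lemma ext_sub (p : R) f g : 1 <= p -> cLp mu p%:E f -> cLp mu p%:E g ->
  \forall x \ae mu, S (fun y => f y - g y) x = S f x - S g x.
Proof.
move=> p1 Lf Lg; case: extS => _ lin _ _ _.
have := lin (-1) g f (cLp_L1_plus_Loo p1 Lg) (cLp_L1_plus_Loo p1 Lf).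
rewrite (_ : (fun y => -1 * g y + f y) = (fun y => f y - g y)); last first.
  by apply/funext => y; rewrite mulN1r addrC.
by apply: filterS => x ->; rewrite mulN1r addrC.
Qed.

Lemma ext_dist (p : R) f g : 1 <= p -> cLp mu p%:E f -> cLp mu p%:E g ->
  (cdist mu p%:E (S f) (S g) <= (ext_const p)%:E * cdist mu p%:E f g)%E.
Proof.
move=> p1 Lf Lg; have Lfg := cLpB p1 Lf Lg.
apply: le_trans (ext_Lp_bound p1 Lfg); apply: le_cnorm.
- by rewrite (lt_le_trans _ p1).
- by apply: cmeasurableB; [exact: ext_mble Lf|exact: ext_mble Lg].
- exact: ext_mble Lfg.
- by apply: filterS (ext_sub p1 Lf Lg) => x ->.
Qed.

End Extension.

(** * Uniform continuity of orbits in L^1 and L^p *)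

Section Semigroup.
Context {d : measure_display} {Omega : measurableType d} {R : realType}.
Variable mu : {measure set Omega -> \bar R}.
Variables T Text : R -> (Omega -> R[i]) -> (Omega -> R[i]).
Hypotheses (sgT : ds_semigroup mu T) (scT : strongly_continuous_L1 mu T).
Hypothesis extT : forall s : R, 0 <= s -> ds_extension mu (T s) (Text s).
Implicit Types (f g h : Omega -> R[i]).

Lemma sg_ds s : 0 <= s -> dunford_schwartz mu (T s).
Proof. by case: sgT => h _ _; exact: h. Qed.

Lemma sg_L1 s f : 0 <= s -> cLp mu 1 f -> cLp mu 1 (T s f).
Proof. by move=> s0 Lf; exact: (ds_L1 (sg_ds s0) Lf). Qed.

Lemma sg_continuous0 f (e : R) : cLp mu 1 f -> 0 < e ->
  exists2 del : R, 0 < del & forall s : R, 0 <= s -> s <= del -> (cdist mu 1 (T s f) f <= e%:E)%E.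
Proof.
move=> Lf e0.
have /nbhs_ballP[del /= del0 H] : within [set s | 0 <= s] (nbhs (0 : R))
    [set s | (cdist mu 1 (T s f) (T 0 f) <= e%:E)%E].
  exact: (ge0_cvge0P (fun s => cnorm_ge0 mu _ _)).1 (scT Lf (lexx 0)) _ e0.
exists (del / 2); first by rewrite divr_gt0.
move=> s s0 sd; have sb : ball 0 del s.
  rewrite /ball/= sub0r normrN ger0_norm// (le_lt_trans sd)//.
  by rewrite ltr_pdivrMr// ltr_pMr// ltr1n.
have := H s sb s0; rewrite /cdist.
case: sgT => _ T0 _.
rewrite (eq_cnorm ltr01 _ _ (g := fun x => T s f x - f x))//.
- by apply: cmeasurableB; [exact: cLp_measurable (sg_L1 s0 Lf)|exact: cLp_measurable (sg_L1 (lexx 0) Lf)].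
- by apply: cmeasurableB; [exact: cLp_measurable (sg_L1 s0 Lf)|exact: cLp_measurable Lf].
- by apply: filterS (T0 f Lf) => x ->.
Qed.

(** For s' <= s the difference is T_s' applied to T_(s-s') f - f, so by contraction the modulus of
    continuity at 0 serves at every time. *)
Lemma sg_unif_L1 f (e : R) : cLp mu 1 f -> 0 < e ->
  exists2 del : R, 0 < del & forall s s' : R, 0 <= s -> 0 <= s' -> `|s - s'| <= del ->
    (cdist mu 1 (T s f) (T s' f) <= e%:E)%E.
Proof.
move=> Lf e0; have [del del0 H] := sg_continuous0 Lf e0.
exists del => // s s'; wlog ss' : s s' / s' <= s.
  move=> W s0 s'0 sd; have [h|/ltW] := leP s' s; first exact: W h s0 s'0 sd.
  by rewrite cdistC => h; apply: W => //; rewrite distrC.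
move=> s0 s'0; rewrite ger0_norm ?subr_ge0// => sd.
have r0 : 0 <= s - s' by rewrite subr_ge0.
have LT := sg_L1 r0 Lf.
apply: le_trans (H _ r0 sd); apply: le_trans (ds_dist (sg_ds s'0) LT Lf).
apply: le_cnorm => //.
- by apply: cmeasurableB; exact: cLp_measurable (sg_L1 _ Lf).
- by apply: cmeasurableB; [exact: cLp_measurable (sg_L1 _ LT)|exact: cLp_measurable (sg_L1 _ Lf)].
case: sgT => _ _ sg; have := sg s' (s - s') f s'0 r0 Lf; rewrite subrKC.
by apply: filterS => x ->.
Qed.

(** Replace f by a bounded integrable h, at a cost uniform in time. For h the difference of two
    orbit points is bounded by 2c, so its L^p norm is controlled by its L^1 norm. *)
Lemma sg_unif_Lp (p : R) f (e : R) : 1 <= p -> cLp mu p%:E f -> 0 < e ->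
  exists2 del : R, 0 < del & forall s s' : R, 0 <= s -> 0 <= s' -> `|s - s'| <= del ->
    (cdist mu p%:E (Text s f) (Text s' f) <= e%:E)%E.
Proof.
move=> p1 Lf e0; have p0 : 0 < p by rewrite (lt_le_trans _ p1).
(* Adding 1 only makes the divisor positive; the same device recurs below. *)
pose K := ext_const p + 1.
have K0 : 0 < K by rewrite ltr_wpDl ?ext_const_ge0.
pose eta := e / 3 / K.
have eta0 : 0 < eta by rewrite !divr_gt0.
have [h [c [c0 L1h Lph hc fh]]] := cLp_dense p1 eta0 Lf.
pose D := (2 * c) `^ (p - 1) + 1.
have D0 : 0 < D by rewrite ltr_wpDl ?powR_ge0.
have e1 : 0 < (e / 3) `^ p / D by rewrite divr_gt0// powR_gt0// divr_gt0.
have [del del0 H] := sg_unif_L1 L1h e1.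
exists del => // s s' s0 s'0 sd.
have mT r : 0 <= r -> cmeasurable (T r h) by move=> r0; exact: cLp_measurable (sg_L1 r0 L1h).
have mE r g : 0 <= r -> cLp mu p%:E g -> cmeasurable (Text r g).
  by move=> r0 Lg; apply: (ext_mble (extT r0) p1 Lg).
have near_h r : 0 <= r -> (cdist mu p%:E (Text r f) (Text r h) <= (e / 3)%:E)%E.
  move=> r0; apply: (le_trans (ext_dist (sg_ds r0) (extT r0) p1 Lf Lph)).
  apply: (@le_trans _ _ (K%:E * eta%:E)%E).
    by apply: lee_pmul; rewrite ?lee_fin ?ext_const_ge0 ?cnorm_ge0 ?lerDl.
  by rewrite -EFinM lee_fin /eta mulrC divfK ?gt_eqF.
have hb r : 0 <= r -> \forall x \ae mu, normc (T r h x) <= c.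
  by move=> r0; apply: (ds_bound (sg_ds r0) L1h c0); exact: nearW.
have mid : (cdist mu p%:E (Text s h) (Text s' h) <= (e / 3)%:E)%E.
  rewrite /cdist (eq_cnorm p0 _ _ (g := fun x => T s h x - T s' h x)); last 3 first.
  - by apply: cmeasurableB; exact: mE.
  - by apply: cmeasurableB; exact: mT.
  - by apply: filterS2 (ext_L1 (extT s0) L1h) (ext_L1 (extT s'0) L1h) => x -> ->.
  rewrite -(lee_poweR_inv p0) ?cnorm_ge0 ?lee_fin ?divr_ge0 ?(ltW e0)//.
  apply: (le_trans (@interpolation_L1_Loo _ _ _ mu p (2 * c) _ p1 _ _ _)).
  - by rewrite mulr_ge0.
  - by apply: cmeasurableB; exact: mT.
  - apply: filterS2 (hb s s0) (hb s' s'0) => x h1 h2.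
    by rewrite (le_trans (normcB _ _))// mulr2n mulrDl mul1r lerD.
  apply: (@le_trans _ _ (D%:E * ((e / 3) `^ p / D)%:E)%E).
    by apply: lee_pmul; rewrite ?lee_fin ?powR_ge0 ?cnorm_ge0 ?lerDl//; exact: H.
  by rewrite -EFinM poweR_EFin lee_fin mulrC divfK ?gt_eqF.
apply: (le_trans (cdist_triangle mu p1 (mE s f s0 Lf) (mE s h s0 Lph) (mE s' f s'0 Lf))).
have -> : e%:E = ((e / 3)%:E + ((e / 3)%:E + (e / 3)%:E))%E :> \bar R.
  by rewrite -!EFinD; congr EFin; field.
apply: leeD; first exact: near_h.
apply: (le_trans (cdist_triangle mu p1 (mE s h s0 Lph) (mE s' h s'0 Lph) (mE s' f s'0 Lf))).
by apply: leeD => //; rewrite cdistC; exact: near_h.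
Qed.

End Semigroup.

(** * Completeness of [L^p] *)

Section LimitTools.
Context {R : realType}.

Lemma cvg_powR_nneg (p l : R) (y : nat -> R) : 1 <= p -> (forall n, 0 <= y n) ->
  y n @[n --> \oo] --> l -> y n `^ p @[n --> \oo] --> l `^ p.
Proof.
move=> p1 y0 yl; have p0 : 0 < p by rewrite (lt_le_trans _ p1).
have : 0 <= l by rewrite -(cvg_lim _ yl)//; apply: limr_ge; [apply/cvg_ex; eexists; exact: yl|exact: nearW].
rewrite le_eqVlt => /predU1P[l0|l0]; last first.
  apply: (cvg_comp _ (fun a : R => a `^ p) yl).
  have df : differentiable (fun a : R => a `^ p) l; last exact: (differentiable_continuous df).
  apply/derivable1_diffP.
  by apply: derivable_powR; rewrite in_itv/= l0.
(* At the limit 0 the differentiability argument is replaced by a squeeze: y^p <= y as soon as y <=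
   1. *)
rewrite -l0 powR0 ?gt_eqF//; rewrite -l0 in yl.
apply: (@squeeze_cvgr _ _ _ _ (fun=> 0) y) => //; last exact: cvg_cst.
near=> n; rewrite powR_ge0/= -(mulr_powRB1 (y0 n) p0) ler_piMr//.
have e1 : (1 : R) `^ (p - 1) = 1 by rewrite powR1.
rewrite -[leRHS]e1 ge0_ler_powR ?subr_ge0// ?nnegrE//.
by near: n; apply: (cvgr_le _ yl); exact: ltr01.
Unshelve. all: by end_near. Qed.

Lemma cvg_normc (z : nat -> R[i]) (l : R[i]) :
  Re (z n) @[n --> \oo] --> Re l -> Im (z n) @[n --> \oo] --> Im l ->
  normc (z n) @[n --> \oo] --> normc l.
Proof.
move=> /cvgrPdist_le cr /cvgrPdist_le ci; apply/cvgrPdist_le => e e0.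
have e20 : 0 < e / 2 by rewrite divr_gt0.
apply: filterS2 (cr _ e20) (ci _ e20) => n hr hi.
have h1 : normc (l - z n) <= e.
  rewrite (le_trans (normc_leD _))// ReD ImD.
  have -> : Re (- z n) = - Re (z n) by case: (z n).
  have -> : Im (- z n) = - Im (z n) by case: (z n).
  by lra.
have h2 := normcD (l - z n) (z n); have h3 := normcD (z n - l) l.
rewrite subrK in h2; rewrite subrK normc_distC in h3.
by rewrite ler_norml; apply/andP; split; lra.
Qed.

Lemma cvgn_of_bounded_variation (a w : nat -> R) (M : R) :
  (forall k, `|a k.+1 - a k| <= w k) -> (forall N, \sum_(k < N) w k <= M) -> cvgn a.
Proof.
move=> aw wM.
have w0 k : 0 <= w k by rewrite (le_trans _ (aw k)).
pose t k := a k.+1 - a k.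
have ct : cvgn (series t).
  apply: normed_cvg; apply: (@series_le_cvg _ _ w) => //; first by move=> k; exact: normr_ge0.
  apply: nondecreasing_is_cvgn.
    by apply/nondecreasing_seqP => n; rewrite /series/= big_nat_recr//= lerDl.
  by exists M => _ [n _ <-]; rewrite /series/= big_mkord.
have aE : a = (fun n => a 0 + series t n).
  apply/funext => n; rewrite /series/= /t telescope_sumr//; by rewrite subrKC.
by rewrite aE; apply: is_cvgD => //; exact: is_cvg_cst.
Qed.

End LimitTools.

Section Fatou.
Context {d : measure_display} {Omega : measurableType d} {R : realType}.
Variable mu : {measure set Omega -> \bar R}.
Local Open Scope ereal_scope.

Lemma integral_cvg_le (f_ : nat -> Omega -> \bar R) (f : Omega -> \bar R) (B : \bar R) :
  (forall n, measurable_fun setT (f_ n)) -> (forall n x, 0 <= f_ n x) ->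
  (forall x, f_ n x @[n --> \oo] --> f x) ->
  (\forall n \near \oo, \int[mu]_x f_ n x <= B) -> \int[mu]_x f x <= B.
Proof.
move=> mf f0 cf fB.
have -> : \int[mu]_x f x = \int[mu]_x limn_einf (f_^~ x).
  apply: eq_integral => x _; rewrite is_cvg_limn_einfE.
    by apply/esym/cvg_lim => //; exact: cf.
  by apply/cvg_ex; eexists; exact: cf.
apply: (le_trans (fatou mu measurableT mf (fun n x _ => f0 n x))).
rewrite limn_einf_lim; apply: lime_le; first exact: is_cvg_einfs.
apply: filterS fB => n; apply: le_trans; apply: ereal_inf_lbound.
by exists n => /=.
Qed.

End Fatou.

Section Completeness.
Context {d : measure_display} {Omega : measurableType d} {R : realType}.
Variable mu : {measure set Omega -> \bar R}.

(** Riesz-Fischer for a rapidly Cauchy sequence: the sum of the moduli of the increments has L^p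
    norm at most 2, hence is finite almost everywhere. The sequence then converges pointwise off a
    null set, and Fatou's lemma gives the rate. *)
Lemma cLp_complete (p : R) (u : nat -> Omega -> R[i]) : 1 <= p ->
  (forall n, cLp mu p%:E (u n)) ->
  (forall n, (cdist mu p%:E (u n) (u n.+1) <= (2^-1 ^+ n)%:E)%E) ->
  exists2 I, cLp mu p%:E I & forall n, (cdist mu p%:E (u n) I <= (2 * 2^-1 ^+ n)%:E)%E.
Proof.
move=> p1 Lu uc; have p0 : 0 < p by rewrite (lt_le_trans _ p1).
have mu_ n := cLp_measurable (Lu n).
pose w k x := normc (u k.+1 x - u k x).
have mw k : measurable_fun setT (w k) by apply: measurable_normc; exact: cmeasurableB.
have w0 k x : 0 <= w k x by exact: normc_ge0.
pose G N x := \sum_(k < N) w k x.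
have mG N : measurable_fun setT (G N) by exact: measurable_sum.
have G0 N x : 0 <= G N x by exact: sumr_ge0.
have Gnd x : nondecreasing_seq (G ^~ x).
  by apply/nondecreasing_seqP => N; rewrite /G big_ord_recr/= lerDl.
have dist_le n m : (cdist mu p%:E (u n) (u (n + m)%N) <= (2 * 2^-1 ^+ n)%:E)%E.
  (* The exact partial geometric sum, so that the induction on m closes. *)
  have : (cdist mu p%:E (u n) (u (n + m)%N) <= (2 * 2^-1 ^+ n - 2 * 2^-1 ^+ (n + m))%:E)%E.
    elim: m => [|m ih].
      rewrite addn0 subrr /cdist; under [X in cnorm _ _ X]eq_fun do rewrite subrr.
      by rewrite cnorm0.
    rewrite addnS; apply: le_trans (cdist_triangle mu p1 (mu_ n) (mu_ (n + m)%N) (mu_ _)) _.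
    apply: (le_trans (leeD ih (uc _))); rewrite -EFinD lee_fin exprS; lra.
  move=> /le_trans; apply; rewrite lee_fin gerBl mulr_ge0// exprn_ge0//.
have GN N : (cnorm mu p%:E (fun x => (G N x)%:C) <= 2%:E)%E.
  rewrite (_ : (fun x => _) = (fun x => \sum_(k < N) (w k x)%:C)); last first.
    by apply/funext => x; rewrite rmorph_sum.
  apply: (le_trans (cnorm_sum _ _ p1 _)); first by move=> k; apply: cmeasurable_real.
  apply: (@le_trans _ _ (\sum_(k < N) (2^-1 ^+ k)%:E)%E).
    apply: lee_sum => k _; rewrite (_ : cnorm _ _ _ = cdist mu p%:E (u k) (u k.+1))//.
    rewrite cdistC; apply: eq_Lnorm => x; rewrite normcR ger0_norm//.
  rewrite sumEFin lee_fin.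
  suff -> : \sum_(k < N) 2^-1 ^+ k = 2 - 2 * 2^-1 ^+ N :> R by rewrite gerBl mulr_ge0// exprn_ge0.
  by elim: N => [|N ih]; [rewrite big_ord0; lra|rewrite big_ord_recr/= ih exprS; lra].
pose GP N x : \bar R := ((G N x) `^ p)%:E.
have mGP N : measurable_fun setT (GP N).
  by apply/measurable_EFinP; apply: (@measurableT_comp _ _ _ _ _ _ (@powR R ^~ p)).
have GP0 N x : (0 <= GP N x)%E by rewrite lee_fin powR_ge0.
have cGP x : cvgn (GP ^~ x).
  apply: ereal_nondecreasing_is_cvgn => m n mn; rewrite lee_fin ge0_ler_powR ?nnegrE ?(ltW p0)//.
  exact: Gnd.
have intG : (\int[mu]_x limn (GP ^~ x) <= (2 `^ p)%:E)%E.
  apply: (integral_cvg_le mGP GP0) => //; apply: nearW => N.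
  have := GN N; rewrite -(lee_poweR_inv p0) ?cnorm_ge0// cnorm_poweR// poweR_EFin.
  congr (_ <= _)%E; apply: eq_integral => x _.
  by rewrite normcR ger0_norm.
have limG0 x : (0 <= limn (GP ^~ x))%E by apply: lime_ge => //; exact: nearW.
have [Nul [mNul Nul0 HN]] : \forall x \ae mu, limn (GP ^~ x) \is a fin_num.
  have ig : mu.-integrable setT (fun x => limn (GP ^~ x)).
    apply/integrableP; split; first by apply: (emeasurable_fun_cvg _ _ mGP).
    by under eq_integral do rewrite gee0_abs//; rewrite (le_lt_trans intG)// ltry.
  by apply: filterS (integrable_ae measurableT ig) => x; exact.
pose Z := ~` Nul.
have mZ : measurable Z by exact: measurableC.
have Zbound x : Z x -> exists M, forall N, G N x <= M.
  move=> Zx; have fx : limn (GP ^~ x) \is a fin_num.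
    by apply: contrapT => h; apply: Zx; exact: HN.
  exists (fine (limn (GP ^~ x)) `^ p^-1) => N.
  have GL : (G N x) `^ p <= fine (limn (GP ^~ x)).
    rewrite -lee_fin fineK//; apply: lime_ge => //; near=> n.
    rewrite lee_fin ge0_ler_powR ?nnegrE ?(ltW p0)//; apply: Gnd.
    by near: n; exact: nbhs_infty_ge.
  have -> : G N x = (G N x `^ p) `^ p^-1 by rewrite -powRrM mulfV ?gt_eqF// powRr1.
  by rewrite ge0_ler_powR ?nnegrE ?powR_ge0 ?invr_ge0 ?(ltW p0) ?fine_ge0.
(* Setting the sequence to 0 off [Z] makes it converge everywhere, so its limit is a measurable
   function. *)
pose v n x := (\1_Z x : R)%:C * u n x.
have mv n : cmeasurable (v n).
  by apply: cmeasurableM => //; apply: cmeasurable_real; exact: measurable_indic.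
have vE n x : Z x -> v n x = u n x by move=> Zx; rewrite /v indicE mem_set// mul1r.
have v0 n x : ~ Z x -> v n x = 0 by move=> Zx; rewrite /v indicE memNset// mul0r.
have cv x : cvgn (fun n => Re (v n x)) /\ cvgn (fun n => Im (v n x)).
  have [Zx|Zx] := pselect (Z x); last first.
    by under eq_fun do rewrite v0//; under [X in _ /\ cvgn X]eq_fun do rewrite v0//; split; exact: is_cvg_cst.
  have [M HM] := Zbound x Zx.
  split; apply: (@cvgn_of_bounded_variation _ _ (w ^~ x) M) => // k; rewrite !vE//.
    apply: le_trans (normr_Re_le _); rewrite ReD; by case: (u k x).
  apply: le_trans (normr_Im_le _); rewrite ImD; by case: (u k x).
pose I x : R[i] := (limn (fun n => Re (v n x))) +i* (limn (fun n => Im (v n x))).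
have mI : cmeasurable I.
  split; apply: (measurable_fun_cvg (h := fun n x => _)).
  - by move=> n; exact: (mv n).1.
  - by move=> x _; exact: (cv x).1.
  - by move=> n; exact: (mv n).2.
  - by move=> x _; exact: (cv x).2.
have dist_I n : (cdist mu p%:E (u n) I <= (2 * 2^-1 ^+ n)%:E)%E.
  have n20 : 0 <= 2 * 2^-1 ^+ n :> R by rewrite mulr_ge0// exprn_ge0// invr_ge0.
  have uv m : \forall x \ae mu, u m x = v m x.
    exists Nul; split => // x /= ne; apply: contrapT => Zx; apply: ne.
    by rewrite vE.
  rewrite /cdist (eq_cnorm p0 _ _ (g := fun x => v n x - I x)); last 3 first.
  - exact: cmeasurableB.
  - exact: cmeasurableB.
  - by apply: filterS (uv n) => x ->.
  rewrite -(lee_poweR_inv p0) ?cnorm_ge0// cnorm_poweR//.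
  apply: (integral_cvg_le (f_ := fun m x => (normc (v n x - v (n + m)%N x) `^ p)%:E)).
  - by move=> m; apply: measurable_normc_powR; exact: cmeasurableB.
  - by move=> m x; rewrite lee_fin powR_ge0.
  - move=> x; apply/cvg_EFin; first exact: nearW.
    apply: cvg_powR_nneg => //; first by move=> m; exact: normc_ge0.
    have ReB (a b : R[i]) : Re (a - b) = Re a - Re b by case: a; case: b.
    have ImB (a b : R[i]) : Im (a - b) = Im a - Im b by case: a; case: b.
    apply: cvg_normc; rewrite ?ReB ?ImB; under eq_fun do rewrite ?ReB ?ImB addnC.
      apply: cvgB; first exact: cvg_cst.
      have := (cv x).1; rewrite -(cvg_shiftn n); exact.
    apply: cvgB; first exact: cvg_cst.
    have := (cv x).2; rewrite -(cvg_shiftn n); exact.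
  - apply: nearW => m; rewrite -cnorm_poweR// lee_poweR_inv ?cnorm_ge0//.
    rewrite (eq_cnorm p0 _ _ (g := fun x => u n x - u (n + m)%N x)).
    + exact: dist_le.
    + exact: cmeasurableB.
    + exact: cmeasurableB.
    + by apply: filterS2 (uv n) (uv (n + m)%N) => x -> ->.
exists I => //.
have L0 : cLp mu p%:E (fun x => u 0 x - I x).
  split; first exact: cmeasurableB.
  by rewrite (le_lt_trans (dist_I 0))// ltry.
rewrite (_ : I = (fun x => u 0 x - (u 0 x - I x))); first exact: cLpB.
by apply/funext => x; rewrite opprB addrC subrK.
Unshelve. all: by end_near. Qed.

End Completeness.

(** * Bochner integrals of continuous orbits *)

Section SimpleFunctions.
Context {d : measure_display} {Omega : measurableType d} {R : realType}.
Variable mu : {measure set Omega -> \bar R}.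
Variable p : R.
Hypothesis p1 : 1 <= p.
Local Notation leb := (@lebesgue_measure R).
Implicit Types (G : seq (set R * (Omega -> R[i]))) (g h : Omega -> R[i]) (A B D : set R).

Let p0 : 0 < p. Proof. by rewrite (lt_le_trans _ p1). Qed.

Lemma is_simple_cons a b A g G : is_simple mu p%:E a b ((A, g) :: G) ->
  [/\ measurable A, A `<=` `[a, b], cLp mu p%:E g & is_simple mu p%:E a b G].
Proof.
move=> sG; have [mA Aab Lg] := sG 0%N isT; split => // i iG.
exact: (sG i.+1).
Qed.

Lemma is_simple_cat a b G G' : is_simple mu p%:E a b G -> is_simple mu p%:E a b G' ->
  is_simple mu p%:E a b (G ++ G').
Proof.
move=> sG sG' i; rewrite size_cat nth_cat; case: ifPn => [iG _|]; first exact: sG.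
by rewrite -leqNgt => Gi iGG; apply: sG'; rewrite ltn_subLR.
Qed.

Definition simple_opp G := [seq (Ag.1, fun x => - Ag.2 x) | Ag <- G].

Lemma is_simple_opp a b G : is_simple mu p%:E a b G -> is_simple mu p%:E a b (simple_opp G).
Proof.
move=> sG i; rewrite size_map => iG; rewrite (nth_map (set0, fun=> 0))//=.
have [mA Aab Lg] := sG i iG; split => //.
by under eq_fun do rewrite -mulN1r; exact: cLpZ.
Qed.

Lemma simple_val_cons A g G s x :
  simple_val ((A, g) :: G) s x = (\1_A s : R)%:C * g x + simple_val G s x.
Proof. by rewrite /simple_val big_cons. Qed.

Lemma simple_val_opp G s x : simple_val (simple_opp G) s x = - simple_val G s x.
Proof.
rewrite /simple_val big_map -sumrN.
by apply: eq_bigr => Ag _; rewrite mulrN.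
Qed.

Lemma simple_val_cat G G' s x :
  simple_val (G ++ G') s x = simple_val G s x + simple_val G' s x.
Proof. by rewrite /simple_val big_cat. Qed.

Lemma cLp_simple_val a b G s : is_simple mu p%:E a b G -> cLp mu p%:E (simple_val G s).
Proof.
elim: G => [|[A g] G ih].
  move=> _; rewrite (_ : simple_val _ _ = fun=> 0); first exact: cLp0.
  by apply/funext => x; rewrite /simple_val big_nil.
move=> /is_simple_cons[_ _ Lg sG].
rewrite (_ : simple_val _ _ = fun x => (\1_A s : R)%:C * g x + simple_val G s x).
  by apply: cLpD => //; [exact: cLpZ|exact: ih].
by apply/funext => x; rewrite simple_val_cons.
Qed.

Lemma cLp_simple_integral a b G : is_simple mu p%:E a b G -> cLp mu p%:E (simple_integral G).
Proof.
elim: G => [|[A g] G ih].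
  move=> _; rewrite (_ : simple_integral _ = fun=> 0); first exact: cLp0.
  by apply/funext => x; rewrite /simple_integral big_nil.
move=> /is_simple_cons[_ _ Lg sG].
rewrite (_ : simple_integral _ = fun x => (fine (leb A))%:C * g x + simple_integral G x).
  by apply: cLpD => //; [exact: cLpZ|exact: ih].
by apply/funext => x; rewrite /simple_integral big_cons.
Qed.

(** The domain [D] and the shift [g] are generalised for the induction: on [D] inside the first
    piece A its value h is absorbed into [g], and outside A the piece disappears. [K] will be 0 or
    an orbit. *)
Lemma measurable_cnorm_simple a b G (K : R -> Omega -> R[i]) D g :
  is_simple mu p%:E a b G -> measurable D -> cLp mu p%:E g ->
  (forall g, cLp mu p%:E g -> measurable_fun D (fun s => cnorm mu p%:E (fun x => K s x + g x))) ->
  measurable_fun D (fun s => cnorm mu p%:E (fun x => K s x + (g x + simple_val G s x))).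
Proof.
elim: G D g => [|[A h] G ih] D g.
  move=> _ mD Lg mK.
  apply: eq_measurable_fun (mK g Lg) => s _; apply: eq_Lnorm => x.
  by rewrite /simple_val big_nil addr0.
move=> /is_simple_cons[mA _ Lh sG] mD Lg mK.
have mDA : measurable (D `&` A) by exact: measurableI.
have mDnA : measurable (D `\` A) by exact: measurableD.
rewrite -(setUIDK D A); apply/measurable_funU => //; split.
- apply: (eq_measurable_fun (fun s => cnorm mu p%:E (fun x => K s x + ((g x + h x) + simple_val G s x)))).
    move=> s; rewrite inE => -[_ As]; apply: eq_Lnorm => x.
    by rewrite simple_val_cons indicE mem_set// mul1r -(addrA (g x)).
  apply: ih => //; first exact: cLpD.
  by move=> g' Lg'; apply: measurable_funS (mK g' Lg').
- apply: (eq_measurable_fun (fun s => cnorm mu p%:E (fun x => K s x + (g x + simple_val G s x)))).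
    move=> s; rewrite inE => -[_ As]; apply: eq_Lnorm => x.
    by rewrite simple_val_cons indicE memNset// mul0r add0r.
  apply: ih => //.
  by move=> g' Lg'; apply: measurable_funS (mK g' Lg').
Qed.

Let fine_splitI A B : measurable A -> measurable B -> (leb B < +oo)%E ->
  fine (leb B) = fine (leb (B `&` A)) + fine (leb (B `\` A)).
Proof.
move=> mA mB Boo.
have fin C : measurable C -> C `<=` B -> leb C \is a fin_num.
  by move=> mC CB; rewrite ge0_fin_numE// (le_lt_trans _ Boo)// le_measure ?inE.
have mBA : measurable (B `&` A) by exact: measurableI.
have mBnA : measurable (B `\` A) by exact: measurableD.
rewrite -fineD; [|by apply: fin => //; exact: subIsetl|by apply: fin => //; exact: subDsetl].
rewrite -measureU// ?setUIDK//.
by rewrite setDE setIACA setICr setI0.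
Qed.

(* Inserting the pieces of [G] one at a time splits [B] into the atoms on which
   the simple function is constant, so the pieces of [G] may overlap. *)
Lemma cnorm_simple_integral_on a b G B g :
  is_simple mu p%:E a b G -> measurable B -> (leb B < +oo)%E -> cLp mu p%:E g ->
  (cnorm mu p%:E (fun x => ((fine (leb B))%:C * g x
      + \sum_(Ag <- G) (fine (leb (Ag.1 `&` B)))%:C * Ag.2 x)%R)
   <= \int[leb]_(s in B) cnorm mu p%:E (fun x => g x + simple_val G s x)%R)%E.
Proof.
elim: G B g => [|[A h] G ih] B g.
  move=> _ mB Boo Lg; under [X in (cnorm _ _ X <= _)%E]eq_fun do rewrite big_nil addr0.
  under eq_integral do under eq_fun do rewrite /simple_val big_nil addr0.
  rewrite cnormZ//; last exact: cLp_measurable Lg.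
  rewrite integral_cst// normcR ger0_norm ?fine_ge0// fineK ?ge0_fin_numE//.
  by rewrite muleC.
move=> sAG mB Boo Lg; have [mA _ Lh sG] := is_simple_cons sAG.
have mBA : measurable (B `&` A) by exact: measurableI.
have mBnA : measurable (B `\` A) by exact: measurableD.
have BAoo : (leb (B `&` A) < +oo)%E.
  by rewrite (le_lt_trans _ Boo)// le_measure ?inE//; exact: subIsetl.
have BnAoo : (leb (B `\` A) < +oo)%E.
  by rewrite (le_lt_trans _ Boo)// le_measure ?inE//; exact: subDsetl.
have Lgh := cLpD p1 Lg Lh.
have dis : [disjoint B `&` A & B `\` A].
  by apply/disj_setPS; rewrite setDE setIACA setICr setI0.
have mval : measurable_fun B (fun s => cnorm mu p%:E (fun x => g x + simple_val ((A, h) :: G) s x)).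
  have := @measurable_cnorm_simple a b ((A, h) :: G) (fun _ _ => 0) B g sAG mB Lg.
  under [X in measurable_fun _ X]eq_fun do under eq_fun do rewrite add0r.
  apply => g' _; exact: measurable_cst.
rewrite -[X in (_ <= \int[_]_(_ in X) _)%E](setUIDK B A) ge0_integral_setU//; last first.
  by rewrite setUIDK.
have i1 : (\int[leb]_(s in B `&` A) cnorm mu p%:E (fun x => g x + simple_val ((A, h) :: G) s x)%R =
  \int[leb]_(s in B `&` A) cnorm mu p%:E (fun x => (g x + h x) + simple_val G s x)%R)%E.
  apply: eq_integral => s; rewrite inE => -[_ As]; apply: eq_Lnorm => x.
  by rewrite simple_val_cons indicE mem_set// mul1r addrA.
have i2 : (\int[leb]_(s in B `\` A) cnorm mu p%:E (fun x => g x + simple_val ((A, h) :: G) s x)%R =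
  \int[leb]_(s in B `\` A) cnorm mu p%:E (fun x => g x + simple_val G s x)%R)%E.
  apply: eq_integral => s; rewrite inE => -[_ As]; apply: eq_Lnorm => x.
  by rewrite simple_val_cons indicE memNset// mul0r add0r.
(* The induction hypothesis is used on both halves of [B], with shift g + h inside A and g outside;
   the triangle inequality joins them. *)
rewrite i1 i2; apply: (le_trans _ (leeD (ih _ _ sG mBA BAoo Lgh) (ih _ _ sG mBnA BnAoo Lg))).
have msum C g' : measurable C -> cLp mu p%:E g' -> cmeasurable (fun x => (fine (leb C))%:C * g' x
      + \sum_(Ag <- G) (fine (leb (Ag.1 `&` C)))%:C * Ag.2 x).
  move=> mC Lg'; apply: cmeasurableD; first by apply: cmeasurableZ; exact: cLp_measurable Lg'.
  elim: G sG {ih sAG mval i1 i2} => [|[A' h'] G' ih'] sG'.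
    by under eq_fun do rewrite big_nil; exact: cmeasurable_cst.
  have [_ _ Lh' sG''] := is_simple_cons sG'.
  under eq_fun do rewrite big_cons; apply: cmeasurableD; last exact: ih'.
  by apply: cmeasurableZ; exact: cLp_measurable Lh'.
apply: le_trans (cnormD mu p1 (msum _ _ mBA Lgh) (msum _ _ mBnA Lg)).
rewrite le_eqVlt; apply/orP; left; apply/eqP; apply: eq_Lnorm => x; congr ((normc _)%:E).
rewrite big_cons/= (setIC A) (fine_splitI mA mB Boo) rmorphD/=.
have -> : \sum_(Ag <- G) (fine (leb (Ag.1 `&` B)))%:C * Ag.2 x =
   \sum_(Ag <- G) (fine (leb (Ag.1 `&` (B `&` A))))%:C * Ag.2 x +
   \sum_(Ag <- G) (fine (leb (Ag.1 `&` (B `\` A))))%:C * Ag.2 x.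
  elim: G sG {ih sAG mval i1 i2 msum} => [|[A' h'] G' ih'] sG'; first by rewrite !big_nil addr0.
  have [mA' _ _ sG''] := is_simple_cons sG'.
  rewrite !big_cons/= ih'// (@fine_splitI A (A' `&` B))//; last 2 first.
  - exact: measurableI.
  - apply: le_lt_trans Boo; apply: le_measure; rewrite ?inE //; first exact: measurableI.
  by rewrite rmorphD/= setIA setIDA mulrDl addrACA.
set c1 := (fine _)%:C; set c2 := (fine (leb (B `\` A)))%:C.
rewrite mulrDl mulrDr; ring.
Qed.

Lemma cnorm_simple_integral_le a b G : is_simple mu p%:E a b G ->
  (cnorm mu p%:E (simple_integral G) <= \int[leb]_(s in `[a, b]) cnorm mu p%:E (simple_val G s))%E.
Proof.
move=> sG; have L0 := cLp0 mu p0.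
have aboo : (leb `[a, b]%classic < +oo)%E.
  by rewrite lebesgue_measure_itv/=; case: ifP => _; rewrite ltry.
have := cnorm_simple_integral_on sG (measurable_itv `[a, b]) aboo L0.
rewrite (_ : (fun x => _) = simple_integral G); last first.
  apply/funext => x; rewrite mulr0 add0r /simple_integral.
  elim: G sG => [|[A g] G ih] sG; first by rewrite !big_nil.
  have [mA Aab _ sG'] := is_simple_cons sG.
  by rewrite !big_cons/= ih// setIidl.
by under eq_integral do under eq_fun do rewrite add0r.
Qed.

(** The difference of the integrals is the integral of one simple function, [G] followed by the
    opposite of [G']; its norm is then compared through [H]. Hence the integral does not depend on
    the approximating sequence. *)
Lemma cdist_simple_integral_le a b G G' (H : R -> Omega -> R[i]) :
  is_simple mu p%:E a b G -> is_simple mu p%:E a b G' ->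
  (forall s, s \in `[a, b] -> cLp mu p%:E (H s)) ->
  (forall g, cLp mu p%:E g ->
    measurable_fun `[a, b] (fun s => cnorm mu p%:E (fun x => H s x + g x))) ->
  (cdist mu p%:E (simple_integral G) (simple_integral G') <=
   \int[leb]_(s in `[a, b]) cdist mu p%:E (H s) (simple_val G s)
   + \int[leb]_(s in `[a, b]) cdist mu p%:E (H s) (simple_val G' s))%E.
Proof.
move=> sG sG' LH mH.
have mdist F : is_simple mu p%:E a b F ->
    measurable_fun `[a, b] (fun s => cdist mu p%:E (H s) (simple_val F s)).
  move=> sF; have := measurable_cnorm_simple (is_simple_opp sF) (measurable_itv `[a, b]) (cLp0 mu p0) mH.
  apply: eq_measurable_fun => s _; apply: eq_Lnorm => x.
  by rewrite simple_val_opp add0r.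
rewrite -ge0_integralD//; last 4 first.
- by move=> s _; exact: cnorm_ge0.
- exact: mdist.
- by move=> s _; exact: cnorm_ge0.
- exact: mdist.
have sC := is_simple_cat sG (is_simple_opp sG').
have -> : cdist mu p%:E (simple_integral G) (simple_integral G') =
    cnorm mu p%:E (simple_integral (G ++ simple_opp G')).
  apply: eq_Lnorm => x; congr (normc _)%:E; rewrite /simple_integral big_cat/=; congr (_ + _).
  by rewrite big_map -sumrN; apply: eq_bigr => Ag _; rewrite mulrN.
apply: (le_trans (cnorm_simple_integral_le sC)); apply: ge0_le_integral => //.
- have := @measurable_cnorm_simple a b _ (fun _ _ => 0) `[a, b] (fun=> 0) sC (measurable_itv _) (cLp0 mu p0).
  under [X in measurable_fun _ X]eq_fun do under eq_fun do rewrite !add0r.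
  apply => g' _; exact: measurable_cst.
- by apply: emeasurable_funD; exact: mdist.
move=> s /= sab; have mHs := cLp_measurable (LH s sab).
have mF F : is_simple mu p%:E a b F -> cmeasurable (simple_val F s).
  by move=> sF; exact: cLp_measurable (cLp_simple_val s sF).
rewrite (_ : cnorm _ _ _ = cdist mu p%:E (simple_val G s) (simple_val G' s)); last first.
  by apply: eq_Lnorm => x; rewrite simple_val_cat simple_val_opp.
apply: (le_trans (cdist_triangle mu p1 (mF _ sG) mHs (mF _ sG'))).
by rewrite cdistC.
Qed.

End SimpleFunctions.

(** * Riemann sums of a bounded uniformly continuous orbit *)

Section BochnerIntegral.
Context {d : measure_display} {Omega : measurableType d} {R : realType}.
Variable mu : {measure set Omega -> \bar R}.
Variable p : R.
Hypothesis p1 : 1 <= p.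
Local Notation leb := (@lebesgue_measure R).
Variables (H : R -> Omega -> R[i]) (M : R).
Hypothesis LH : forall s : R, 0 <= s -> cLp mu p%:E (H s).
Hypothesis HM : forall s : R, 0 <= s -> (cnorm mu p%:E (H s) <= M%:E)%E.
Hypothesis unifH : forall e : R, 0 < e -> exists2 del : R, 0 < del &
  forall s s' : R, 0 <= s -> 0 <= s' -> `|s - s'| <= del ->
    (cdist mu p%:E (H s) (H s') <= e%:E)%E.

Let p0 : 0 < p. Proof. by rewrite (lt_le_trans _ p1). Qed.

Let mH s : 0 <= s -> cmeasurable (H s). Proof. by move=> /LH /cLp_measurable. Qed.

Let M0 : 0 <= M.
Proof. by rewrite -lee_fin (le_trans _ (HM (lexx 0))). Qed.

Lemma measurable_cnorm_orbit (t : R) g : cLp mu p%:E g ->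
  measurable_fun `[0, t] (fun s => cnorm mu p%:E (fun x => H s x + g x)).
Proof.
move=> Lg.
(* Freezing the orbit at negative times yields a function continuous on the whole line. *)
pose phi (s : R) := fine (cnorm mu p%:E (fun x => H (Num.max 0 s) x + g x)).
have max0 (s : R) : 0 <= Num.max 0 s by rewrite le_max lexx.
have fin s : 0 <= s -> cnorm mu p%:E (fun x => H s x + g x) \is a fin_num.
  by move=> s0; apply: cLp_fin_num; apply: cLpD => //; exact: LH.
have mHg s : 0 <= s -> cmeasurable (fun x => H s x + g x).
  by move=> s0; apply: cmeasurableD; [exact: mH|exact: cLp_measurable Lg].
have lip s s' (e : R) : 0 <= s -> 0 <= s' -> (cdist mu p%:E (H s) (H s') <= e%:E)%E ->
    fine (cnorm mu p%:E (fun x => H s x + g x)) <=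
    e + fine (cnorm mu p%:E (fun x => H s' x + g x)).
  move=> s0 s'0 he; rewrite -lee_fin EFinD !fineK; [|exact: fin..].
  apply: (le_trans _ (leeD he (lexx _))).
  apply: le_trans (cnormD mu p1 (cmeasurableB (mH s0) (mH s'0)) (mHg s' s'0)).
  rewrite le_eqVlt; apply/orP; left; apply/eqP; apply: eq_Lnorm => x.
  by rewrite addrA subrK.
have cphi : continuous phi.
  move=> s; apply/cvgrPdist_le => e e0; have [del del0 Hd] := unifH e0.
  near=> s'; have d1 : `|Num.max 0 s - Num.max 0 s'| <= del.
    apply: (@le_trans _ _ `|s - s'|).
      have h1 := ler_norm (s - s'); have h2 := ler_norm (s' - s); have h3 := normr_ge0 (s - s').
      rewrite distrC in h2; rewrite ler_norml.
      by apply/andP; split; case: (leP 0 s) => ?; case: (leP 0 s') => ?; lra.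
    by near: s'; apply: cvgr_dist_le => //; exact: cvg_id.
  have l1 := lip _ _ _ (max0 s) (max0 s') (Hd _ _ (max0 s) (max0 s') d1).
  rewrite distrC in d1.
  have l2 := lip _ _ _ (max0 s') (max0 s) (Hd _ _ (max0 s') (max0 s) d1).
  by rewrite /phi ler_norml; apply/andP; split; lra.
apply: (eq_measurable_fun (EFin \o phi)).
  move=> s; rewrite inE/= in_itv/= => /andP[s0 _].
  by rewrite /phi max_r// fineK//; exact: fin.
apply: measurable_funTS; apply/measurable_EFinP; exact: continuous_measurable_fun.
Unshelve. all: by end_near. Qed.

(** Half-open pieces are disjoint, so at most one summand is active at a given time; the right end
    [N%:R * tau] stays uncovered. *)
Definition riemann_simple (tau : R) (N : nat) : seq (set R * (Omega -> R[i])) :=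
  [seq (`[k%:R * tau, k.+1%:R * tau[%classic, H (k%:R * tau)) | k <- iota 0 N].

Definition riemann_sum (tau : R) (N : nat) : Omega -> R[i] :=
  fun x => \sum_(k < N) tau%:C * H (k%:R * tau) x.

Lemma riemann_simpleS tau N : riemann_simple tau N.+1 = riemann_simple tau N ++
  [:: (`[N%:R * tau, N.+1%:R * tau[%classic, H (N%:R * tau))].
Proof. by rewrite /riemann_simple -addn1 iotaD map_cat/= add0n addn1. Qed.

Lemma simple_integral_riemann tau N : 0 < tau ->
  simple_integral (riemann_simple tau N) = riemann_sum tau N.
Proof.
move=> tau0; apply/funext => x; rewrite /simple_integral /riemann_sum.
rewrite big_map -[in iota 0 N](subn0 N) -/(index_iota 0 N) big_mkord.
apply: eq_bigr => k _; congr (_%:C * _).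
rewrite /= lebesgue_measure_itv/= lte_fin ltr_pM2r// ltr_nat leqnn.
by rewrite -EFinD/= -mulrBl -natrB// subSnn mul1r.
Qed.

Lemma is_simple_riemann tau N (t : R) : 0 < tau -> N%:R * tau <= t ->
  is_simple mu p%:E 0 t (riemann_simple tau N).
Proof.
move=> tau0 Nt k; rewrite size_map size_iota => kN.
rewrite (nth_map 0%N) ?size_iota// nth_iota//= add0n; split => //.
- move=> s /=; rewrite !in_itv/= => /andP[ks sk].
  rewrite (le_trans _ ks) ?mulr_ge0 ?(ltW tau0)//= (le_trans (ltW sk))//.
  by rewrite (le_trans _ Nt)// ler_pM2r// ler_nat.
- by apply: LH; rewrite mulr_ge0// ltW.
Qed.

Lemma simple_val_riemann tau N s : 0 < tau -> 0 <= s ->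
  if s < N%:R * tau then exists2 k : nat, `|s - k%:R * tau| <= tau &
      simple_val (riemann_simple tau N) s = H (k%:R * tau)
  else simple_val (riemann_simple tau N) s = fun=> 0.
Proof.
move=> tau0 s0; elim: N => [|N ih].
  rewrite mul0r ltNge s0/=; apply/funext => x.
  by rewrite /simple_val big_nil.
have SE x : simple_val (riemann_simple tau N.+1) s x = simple_val (riemann_simple tau N) s x +
    (\1_(`[N%:R * tau, N.+1%:R * tau[%classic) s : R)%:C * H (N%:R * tau) x.
  by rewrite riemann_simpleS simple_val_cat [in X in _ + X]/simple_val big_seq1.
have NS : N%:R * tau < N.+1%:R * tau by rewrite ltr_pM2r// ltr_nat.
case: ifPn ih => [sN [k kd kE]|]; rewrite -?leNgt.
  rewrite (lt_trans sN NS); exists k => //; rewrite -kE; apply/funext => x.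
  rewrite SE indicE memNset ?mul0r ?addr0//= in_itv/= => /andP[+ _].
  by rewrite leNgt sN.
move=> Ns E0; case: ifPn => [sN|].
  exists N; first by rewrite ger0_norm ?subr_ge0// -natr1 mulrDl mul1r in sN *; lra.
  apply/funext => x; rewrite SE E0 add0r indicE mem_set ?mul1r//=.
  by rewrite in_itv/= Ns sN.
rewrite -leNgt => SN; apply/funext => x; rewrite SE E0 add0r indicE memNset ?mul0r//=.
by rewrite in_itv/= => /andP[_]; rewrite ltNge SN.
Qed.

(** Before N tau each time lies within [tau] of its sampling point, at cost [e]. On the rest of
    [0, t] the step function is 0 and the cost is the norm of the orbit, at most [M]. *)
Lemma riemann_simple_error tau N (t e : R) : 0 < tau -> N%:R * tau <= t ->
  0 <= e -> (forall s s' : R, 0 <= s -> 0 <= s' -> `|s - s'| <= tau ->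
    (cdist mu p%:E (H s) (H s') <= e%:E)%E) ->
  (\int[leb]_(s in `[0%R, t]) cdist mu p%:E (H s) (simple_val (riemann_simple tau N) s)
   <= (e * t + M * (t - N%:R * tau))%:E)%E.
Proof.
move=> tau0 Nt e0 He.
have Nt0 : 0 <= N%:R * tau by rewrite mulr_ge0// ltW.
have t0 : 0 <= t by rewrite (le_trans _ Nt).
pose B : set R := `[N%:R * tau, t]%classic.
have mB : measurable B by exact: measurable_itv.
apply: (@le_trans _ _ (\int[leb]_(s in `[0%R, t]) (e%:E + M%:E * (\1_B s)%:E))%E).
  apply: ge0_le_integral => //.
  - by move=> s _; exact: cnorm_ge0.
  - have sG := is_simple_riemann tau0 Nt.
    have := measurable_cnorm_simple p1 (is_simple_opp p1 sG) (measurable_itv `[0, t]) (cLp0 mu p0)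
      (@measurable_cnorm_orbit t).
    apply: eq_measurable_fun => s _; apply: eq_Lnorm => x.
    by rewrite simple_val_opp add0r.
  - apply: emeasurable_funD => //; apply: measurable_funeM.
    by apply/measurable_EFinP; exact: measurable_indic.
  move=> s /=; rewrite in_itv/= => /andP[s0 st].
  have := @simple_val_riemann tau N s tau0 s0; case: ifPn => [sN [k kd ->]|].
    rewrite -[leLHS]adde0 leeD ?mule_ge0 ?lee_fin//.
    by apply: He => //; rewrite mulr_ge0// ltW.
  rewrite -leNgt => Ns ->; rewrite indicE mem_set ?mule1; last by rewrite /B/= in_itv/= Ns st.
  rewrite -[leLHS]add0e leeD ?lee_fin// /cdist.
  by under [X in cnorm _ _ X]eq_fun do rewrite subr0; exact: HM.
rewrite ge0_integralD//; last 2 first.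
- by move=> s _; rewrite mule_ge0 ?lee_fin.
- by apply: measurable_funeM; apply/measurable_EFinP; exact: measurable_indic.
rewrite integral_cst//= ge0_integralZl//; last first.
  by apply/measurable_EFinP; exact: measurable_indic.
rewrite integral_indic// setIidl; last first.
  by move=> s; rewrite /B/= !in_itv/= => /andP[Ns ->]; rewrite (le_trans Nt0 Ns).
rewrite /B !lebesgue_measure_itv/= !lte_fin EFinD !EFinM.
apply: leeD.
  case: ifPn => [_|]; first by rewrite EFinN sube0.
  by rewrite mule0 mule_ge0// lee_fin.
rewrite lebesgue_measure_itv/= lte_fin.
case: ifPn => [_|_]; first by rewrite EFinB.
by rewrite mule0 mule_ge0// lee_fin subr_ge0.
Qed.

(** This holds for every [I] satisfying the specification, whatever sequence witnesses it. All
    quantitative information on the integral is drawn from here. *)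
Lemma bochner_riemann_error tau N (t e : R) I : 0 < tau -> N%:R * tau <= t ->
  0 <= e -> (forall s s' : R, 0 <= s -> 0 <= s' -> `|s - s'| <= tau ->
    (cdist mu p%:E (H s) (H s') <= e%:E)%E) ->
  is_bochner_integral mu p%:E 0 t H I ->
  (cdist mu p%:E I (riemann_sum tau N) <= (e * t + M * (t - N%:R * tau))%:E)%E.
Proof.
move=> tau0 Nt e0 He [_ LI [G [sG _ /ge0_cvge0P c1 /ge0_cvge0P c2]]].
have sR := is_simple_riemann tau0 Nt.
have LHt s : s \in `[0, t] -> cLp mu p%:E (H s).
  by rewrite in_itv/= => /andP[s0 _]; exact: LH.
apply/lee_addgt0Pr => eta eta0.
have e20 : 0 < eta / 2 by rewrite divr_gt0.
have [N1 _ h1] := c1 (fun n => integral_ge0 _ (fun s _ => cnorm_ge0 _ _ _)) _ e20.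
have [N2 _ h2] := c2 (fun n => cnorm_ge0 _ _ _) _ e20.
pose n := (N1 + N2)%N.
have k1 := h1 n (leq_addr _ _); have k2 := h2 n (leq_addl _ _).
have LG := cLp_simple_integral p1 (sG n).
rewrite -simple_integral_riemann//.
apply: (le_trans (cdist_triangle mu p1 (cLp_measurable LI) (cLp_measurable LG)
  (cLp_measurable (cLp_simple_integral p1 sR)))).
apply: (le_trans (leeD k2 (cdist_simple_integral_le p1 (sG n) sR LHt (@measurable_cnorm_orbit t)))).
apply: (le_trans (leeD (lexx _) (leeD k1 (riemann_simple_error tau0 Nt e0 He)))).
by rewrite -!EFinD lee_fin; lra.
Qed.

Lemma bochner_exists (t : R) : 0 < t -> exists I, is_bochner_integral mu p%:E 0 t H I.
Proof.
move=> t0.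
(* Over [0, t] this gives the error 2^-n / 2, so consecutive integrals differ by at most 2^-n, the
   rate that completeness asks for. *)
pose e n : R := 2^-1 ^+ n / (2 * t).
have e0 n : 0 < e n by rewrite divr_gt0 ?exprn_gt0 ?invr_gt0 ?mulr_gt0.
have et n : e n * t = 2^-1 ^+ n / 2 by rewrite /e; field; rewrite gt_eqF.
have /choice[K HK] : forall n, exists K : nat, forall s s' : R, 0 <= s -> 0 <= s' ->
    `|s - s'| <= t / K.+1%:R -> (cdist mu p%:E (H s) (H s') <= (e n)%:E)%E.
  move=> n; have [del del0 Hd] := unifH (e0 n).
  exists (Num.truncn (t / del)) => s s' s0 s'0 h; apply: Hd => //.
  rewrite (le_trans h)// ler_pdivrMr// mulrC -ler_pdivrMr// ltW//.
  exact: truncnS_gt.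
(* An integral number of equal steps fills [0, t] exactly, so no leftover term appears. *)
pose tau n := t / (K n).+1%:R; pose G n := riemann_simple (tau n) (K n).+1.
have tau0 n : 0 < tau n by rewrite divr_gt0.
have Nt n : (K n).+1%:R * tau n = t by rewrite /tau mulrC divfK// pnatr_eq0.
have sG n : is_simple mu p%:E 0 t (G n) by apply: is_simple_riemann; rewrite ?Nt.
have err n : (\int[leb]_(s in `[0%R, t]) cdist mu p%:E (H s) (simple_val (G n) s) <= (2^-1 ^+ n / 2)%:E)%E.
  have := riemann_simple_error (tau0 n) _ (ltW (e0 n)) (HK n).
  by move=> /(_ (K n).+1 t); rewrite Nt lexx subrr mulr0 addr0 et; apply.
have LHt s : s \in `[0, t] -> cLp mu p%:E (H s).
  by rewrite in_itv/= => /andP[s0 _]; exact: LH.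
have dS n : (cdist mu p%:E (simple_integral (G n)) (simple_integral (G n.+1)) <= (2^-1 ^+ n)%:E)%E.
  apply: (le_trans (cdist_simple_integral_le p1 (sG n) (sG n.+1) LHt (@measurable_cnorm_orbit t))).
  apply: (le_trans (leeD (err n) (err n.+1))); rewrite -EFinD lee_fin exprS.
  have : 0 <= 2^-1 ^+ n :> R by rewrite exprn_ge0 ?invr_ge0.
  by lra.
have small (C eta : R) : 0 <= C -> 0 < eta -> \forall n \near \oo, C * 2^-1 ^+ n <= eta.
  move=> C0 eta0; have cv : 2^-1 ^+ n @[n --> \oo] --> (0 : R).
    by apply: cvg_expr; rewrite ger0_norm ?invr_ge0// invf_lt1// ltr1n.
  have C10 : 0 < C + 1 by rewrite ltr_wpDl.
  apply: filterS (cvgr_le _ cv _ (divr_gt0 eta0 C10)) => n h.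
  apply: (@le_trans _ _ ((C + 1) * 2^-1 ^+ n)).
    by rewrite ler_wpM2r ?exprn_ge0 ?invr_ge0// lerDl.
  by rewrite mulrC -ler_pdivlMr.
have [I LI HI] := cLp_complete p1 (fun n => cLp_simple_integral p1 (sG n)) dS.
exists I; split => //.
exists G; split => //.
(* Only the endpoint [t], which the half-open pieces miss, is excluded. *)
- exists [set t]; split; [exact: measurable_set1|exact: lebesgue_measure_set1|].
  move=> s /= ns; apply: contrapT => st; apply: ns => /andP[s0 s_t].
  have slt : s < t by rewrite lt_neqAle s_t andbT; apply/eqP.
  apply/ge0_cvge0P => [n|eta eta0]; first exact: cnorm_ge0.
  have C0 : 0 <= (2 * t)^-1 by rewrite invr_ge0 mulr_ge0// ltW.
  apply: filterS (small _ _ C0 eta0) => n hn.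
  have := @simple_val_riemann (tau n) (K n).+1 s (tau0 n) s0.
  rewrite Nt slt => -[k kd kE]; rewrite /G kE.
  apply: (@le_trans _ _ (e n)%:E); last by rewrite lee_fin /e mulrC.
  by apply: HK => //; rewrite mulr_ge0// ltW.
- apply/ge0_cvge0P => [n|eta eta0]; first by apply: integral_ge0 => s _; exact: cnorm_ge0.
  apply: filterS (small 2^-1 _ _ eta0) => [n hn|]; last by rewrite invr_ge0.
  by rewrite (le_trans (err n))// lee_fin mulrC.
- apply/ge0_cvge0P => [n|eta eta0]; first exact: cnorm_ge0.
  apply: filterS (small 2 _ _ eta0) => // n hn.
  by rewrite cdistC (le_trans (HI n)).
Qed.

End BochnerIntegral.

(** * The maximal inequality for the semigroup *)

Section LocalErgodic.
Context {d : measure_display} {Omega : measurableType d} {R : realType}.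
Variable mu : {measure set Omega -> \bar R}.
Variables T Text : R -> (Omega -> R[i]) -> (Omega -> R[i]).
Hypotheses (sgT : ds_semigroup mu T) (scT : strongly_continuous_L1 mu T).
Hypothesis extT : forall s : R, 0 <= s -> ds_extension mu (T s) (Text s).
Implicit Types (f g h : Omega -> R[i]) (p : R).

Local Notation dsT := (sg_ds sgT).

Definition orbit_integral p f (t : R) : Omega -> R[i] :=
  bochner_integral mu p%:E 0 t (fun s => Text s f).

Local Notation B := orbit_integral.
Local Notation rs f := (riemann_sum (fun s => Text s f)).

Let orbit_bound p f : R := ext_const p * fine (cnorm mu p%:E f).

Let orbit_bound_ge0 p f : 0 <= orbit_bound p f.
Proof. by rewrite mulr_ge0 ?ext_const_ge0 ?fine_ge0. Qed.

Let orbit_Lp p f : 1 <= p -> cLp mu p%:E f ->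
  forall s : R, 0 <= s -> cLp mu p%:E (Text s f).
Proof. by move=> p1 Lf s s0; exact: (ext_Lp (dsT s0) (extT s0) p1 Lf). Qed.

Let orbit_le p f : 1 <= p -> cLp mu p%:E f ->
  forall s : R, 0 <= s -> (cnorm mu p%:E (Text s f) <= (orbit_bound p f)%:E)%E.
Proof.
move=> p1 Lf s s0; rewrite (le_trans (ext_Lp_bound (dsT s0) (extT s0) p1 Lf))//.
by rewrite EFinM fineK//; exact: cLp_fin_num.
Qed.

Let orbit_unif p f : 1 <= p -> cLp mu p%:E f ->
  forall e : R, 0 < e -> exists2 del : R, 0 < del & forall s s' : R, 0 <= s -> 0 <= s' ->
    `|s - s'| <= del -> (cdist mu p%:E (Text s f) (Text s' f) <= e%:E)%E.
Proof. by move=> p1 Lf e; exact: (sg_unif_Lp sgT scT extT p1 Lf). Qed.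

Lemma orbit_integral_bochner p f t : 1 <= p -> cLp mu p%:E f -> 0 < t ->
  is_bochner_integral mu p%:E 0 t (fun s => Text s f) (B p f t).
Proof.
move=> p1 Lf t0.
have := bochner_exists p1 (orbit_Lp p1 Lf) (orbit_le p1 Lf)
   (orbit_unif p1 Lf) t0.
exact: (@xgetPex _ (fun=> 0) [set I | is_bochner_integral mu p%:E 0 t (fun s => Text s f) I]).
Qed.

Lemma orbit_integral_Lp p f t : 1 <= p -> cLp mu p%:E f -> 0 < t -> cLp mu p%:E (B p f t).
Proof. by move=> p1 Lf t0; case: (orbit_integral_bochner p1 Lf t0). Qed.

Lemma riemann_sum_Lp p f tau N : 1 <= p -> cLp mu p%:E f -> 0 <= tau ->
  cLp mu p%:E (rs f tau N).
Proof.
move=> p1 Lf tau0; apply: cLp_sum => // k; apply: cLpZ; first by rewrite (lt_le_trans _ p1).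
by apply: orbit_Lp => //; rewrite mulr_ge0.
Qed.

Lemma riemann_approx p f t (eta : R) : 1 <= p -> cLp mu p%:E f -> 0 < t -> 0 < eta ->
  exists2 del : R, 0 < del & forall tau N, 0 < tau -> tau <= del -> N%:R * tau <= t ->
    (cdist mu p%:E (B p f t) (rs f tau N) <= (eta + orbit_bound p f * (t - N%:R * tau))%:E)%E.
Proof.
move=> p1 Lf t0 eta0; have e0 : 0 < eta / t by rewrite divr_gt0.
have [del del0 Hd] := orbit_unif p1 Lf e0.
exists del => // tau N tau0 taud Nt.
have := bochner_riemann_error p1 (orbit_Lp p1 Lf) (orbit_le p1 Lf)
   (orbit_unif p1 Lf) tau0 Nt (ltW e0) _ (orbit_integral_bochner p1 Lf t0).
rewrite divfK ?gt_eqF//; apply => s s' s0 s'0 h; apply: Hd => //.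
exact: le_trans taud.
Qed.

(** The free scale [c] lets the mesh divide a prescribed time: c = t fills [0, t] exactly, c = s
    makes T_s a shift of the mesh, and c = 1 gives one mesh common to several times. *)
Lemma riemann_cvg p f t c (eta : R) : 1 <= p -> cLp mu p%:E f -> 0 < t -> 0 < c -> 0 < eta ->
  \forall n \near \oo, (cdist mu p%:E (B p f t)
    (rs f (c / n.+1%:R) (Num.truncn (t / (c / n.+1%:R)))) <= eta%:E)%E.
Proof.
move=> p1 Lf t0 c0 eta0; have e20 : 0 < eta / 2 by rewrite divr_gt0.
have [del del0 Hd] := riemann_approx p1 Lf t0 e20.
pose M := orbit_bound p f; have M0 : 0 <= M := orbit_bound_ge0 p f.
have M10 : 0 < M + 1 by rewrite ltr_wpDl.
pose q := Num.min del (eta / 2 / (M + 1)).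
have q0 : 0 < q by rewrite lt_min del0 divr_gt0.
near=> n; set tau := c / n.+1%:R.
have tau0 : 0 < tau by rewrite divr_gt0.
have tauq : tau <= q.
  rewrite /tau ler_pdivrMr// mulrC -ler_pdivrMr// (@le_trans _ _ n%:R) ?ler_nat//.
  by near: n; exact: nbhs_infty_ger.
have := @truncn_itv _ (t / tau) (divr_ge0 (ltW t0) (ltW tau0)).
set N := Num.truncn _ => /andP[N1 N2].
have NT : N%:R * tau <= t by rewrite -ler_pdivlMr.
have NT2 : t - N%:R * tau <= tau.
  by rewrite lerBlDl -[X in _ + X]mul1r -mulrDl natr1 -ler_pdivrMr// ltW.
move: tauq; rewrite le_min => /andP[td tM].
apply: (le_trans (Hd _ _ tau0 td NT)); rewrite lee_fin [leRHS](splitr eta) lerD2l.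
apply: (@le_trans _ _ ((M + 1) * (eta / 2 / (M + 1)))).
  by rewrite ler_pM// ?subr_ge0// ?lerDl// (le_trans NT2).
by rewrite mulrC divfK// gt_eqF.
Unshelve. all: by end_near. Qed.

(** A single Riemann sum, stopped just below [q], approximates both integrals; for the longer one
    the uncovered stretch costs the orbit bound times its length. *)
Lemma orbit_integral_lip p f (q t : R) : 1 <= p -> cLp mu p%:E f -> 0 < q -> q <= t ->
  (cdist mu p%:E (B p f t) (B p f q) <= (orbit_bound p f * (t - q))%:E)%E.
Proof.
move=> p1 Lf q0 qt; have t0 := lt_le_trans q0 qt.
pose M := orbit_bound p f; have M0 : 0 <= M := orbit_bound_ge0 p f.
have M10 : 0 < M + 1 by rewrite ltr_wpDl.
apply/lee_addgt0Pr => e e0; have e40 : 0 < e / 4 by rewrite divr_gt0.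
have [d1 d10 H1] := riemann_approx p1 Lf t0 e40.
have [d2 d20 H2] := riemann_approx p1 Lf q0 e40.
pose tau := Num.min (Num.min d1 d2) (e / 4 / (M + 1)).
have tau0 : 0 < tau by rewrite !lt_min d10 d20 divr_gt0.
have t1 : tau <= d1 by rewrite !ge_min lexx.
have t2 : tau <= d2 by rewrite !ge_min lexx !orbT.
have t3 : tau <= e / 4 / (M + 1) by rewrite ge_min lexx orbT.
have := @truncn_itv _ (q / tau) (divr_ge0 (ltW q0) (ltW tau0)).
set N := Num.truncn _ => /andP[N1 N2].
have NT : N%:R * tau <= q by rewrite -ler_pdivlMr.
have NT2 : q - N%:R * tau <= tau.
  by rewrite lerBlDl -[X in _ + X]mul1r -mulrDl natr1 -ler_pdivrMr// ltW.
have Mtau : M * (q - N%:R * tau) <= e / 4.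
  apply: (@le_trans _ _ ((M + 1) * (e / 4 / (M + 1)))).
    by rewrite ler_pM// ?subr_ge0// ?lerDl// (le_trans NT2).
  by rewrite mulrC divfK// gt_eqF.
have LB s : 0 < s -> cmeasurable (B p f s).
  by move=> s0; exact: cLp_measurable (orbit_integral_Lp p1 Lf s0).
have Lr := cLp_measurable (riemann_sum_Lp N p1 Lf (ltW tau0)).
apply: (le_trans (cdist_triangle mu p1 (LB t t0) Lr (LB q q0))).
rewrite [X in (_ + X)%E]cdistC.
apply: (le_trans (leeD (H1 _ _ tau0 t1 (le_trans NT qt)) (H2 _ _ tau0 t2 NT))).
rewrite -!EFinD lee_fin -/M.
have -> : t - N%:R * tau = (t - q) + (q - N%:R * tau) by ring.
by rewrite mulrDr; lra.
Qed.

(** Turns Riemann sums of an integrable function into ergodic sums of the single operator [T tau],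
    to which the filling scheme applies. *)
Lemma orbit_iter h tau k : 0 <= tau -> cLp mu 1 h ->
  \forall x \ae mu, Text (k%:R * tau) h x = iter k (T tau) h x.
Proof.
move=> tau0 Lh; have kt n : 0 <= n%:R * tau by rewrite mulr_ge0.
suff : \forall x \ae mu, T (k%:R * tau) h x = iter k (T tau) h x.
  by apply: filterS2 (ext_L1 (extT (kt k)) Lh) => x ->.
elim: k => [|k ih]; first by rewrite mul0r; case: sgT => _ T0 _; exact: T0.
have LT := sg_L1 sgT (kt k) Lh.
case: sgT => _ _ sg; have := sg tau (k%:R * tau) h tau0 (kt k) Lh.
rewrite (_ : tau + k%:R * tau = k.+1%:R * tau); last by rewrite -natr1; ring.
have := ds_ae (dsT tau0) LT (iter_L1 (dsT tau0) Lh k) ih.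
by apply: filterS2 => x /= <-.
Qed.

(** Enumerates the positive rationals; codes of anything else get the harmless value 1, so every
    time is positive. *)
Let rat_time (j : nat) : R :=
  if unpickle j is Some r then if 0 < ratr r :> R then ratr (r : rat) else 1 else 1.

Let rat_time_gt0 j : 0 < rat_time j.
Proof. by rewrite /rat_time; case: unpickle => // r; case: ifP. Qed.

Let over (a : R) r j := [set x | rat_time j * a < normc (B 1 r (rat_time j) x)].

Let mover a r j : cLp mu 1 r -> measurable (over a r j).
Proof.
move=> Lr; have mB := cLp_measurable (orbit_integral_Lp (lexx 1) Lr (rat_time_gt0 j)).
rewrite (_ : over a r j = ~` [set x | normc (B 1 r (rat_time j) x) <= rat_time j * a]).
  apply: measurableC; rewrite -[X in measurable X]setTI.
  exact: (measurable_fun_le measurableT (measurable_normc mB) (measurable_cst _)).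
by apply/seteqP; split => x /=; rewrite /over/= ltNge => /negP.
Qed.

(** With one mesh for all [m] times, a single set [filled] at level a/2 controls all the Riemann
    sums, and the other a/2 covers the Riemann errors off small sets [Z]. Having finitely many times
    allows the total measure of these sets to be at most [e], and the bound obtained is independent
    of [m]. *)
Lemma orbit_maximal_finite a r m : 0 < a -> cLp mu 1 r ->
  (mu (\big[setU/set0]_(j < m) over a r j) <= (2 / a)%:E * cnorm mu 1 r)%E.
Proof.
move=> a0 Lr; apply/lee_addgt0Pr => e e0.
have a20 : 0 < a / 2 by rewrite divr_gt0.
have em : 0 < e / m.+1%:R by rewrite divr_gt0.
pose tau n : R := 1 / n.+1%:R; pose N n j := Num.truncn (rat_time j / tau n).
pose Z n j := [set x | rat_time j * (a / 2) <=
   normc (B 1 r (rat_time j) x - rs r (tau n) (N n j) x)].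
have mdiff n j : cmeasurable (fun x => B 1 r (rat_time j) x - rs r (tau n) (N n j) x).
  apply: cmeasurableB; first exact: cLp_measurable (orbit_integral_Lp (lexx 1) Lr (rat_time_gt0 j)).
  by apply: cLp_measurable (riemann_sum_Lp _ (lexx 1) Lr _); rewrite divr_ge0.
have Zsmall j : \forall n \near \oo, (mu (Z n j) <= (e / m.+1%:R)%:E)%E.
  have [del del0 Hd] := cnorm_small_set mu (@ltr01 R) (mulr_gt0 (rat_time_gt0 j) a20) em.
  apply: filterS (riemann_cvg (lexx 1) Lr (rat_time_gt0 j) (@ltr01 R) del0) => n h.
  exact: (Hd _ (mdiff n j)).
have Zsmalls k : \forall n \near \oo, forall j, (j < k)%N -> (mu (Z n j) <= (e / m.+1%:R)%:E)%E.
  elim: k => [|k ih]; first exact: nearW.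
  apply: filterS2 ih (Zsmall k) => n h1 h2 j; rewrite ltnS leq_eqVlt => /predU1P[->//|].
  exact: h1.
have [n _ /(_ n (leqnn n)) Zn] := Zsmalls m.
have tau0 : 0 < tau n by rewrite divr_gt0.
have dsn := dsT (ltW tau0).
pose F := filled (T (tau n)) r (a / 2).
have mF : measurable F := filled_measurable dsn Lr a20.
have mZ j : measurable (Z n j) by exact: measurable_normc_ge.
apply: (@le_trans _ _ (mu (F `|` \big[setU/set0]_(j < m) Z n j))).
  apply: measure_le_ae.
  - by apply: bigsetU_measurable => j _; exact: mover.
  - by apply: measurableU => //; exact: bigsetU_measurable.
  have Hmax : \forall x \ae mu, forall k, ~ F x ->
      normc (\sum_(i < k) iter i (T (tau n)) r x) <= k%:R * (a / 2).
    by apply: ae_foralln => k; exact: (filled_maximal dsn Lr a20 k).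
  have Horb : \forall x \ae mu, forall k, Text (k%:R * tau n) r x = iter k (T (tau n)) r x.
    by apply: ae_foralln => k; apply: orbit_iter => //; exact: ltW.
  apply: filterS2 Hmax Horb => x hm ho.
  rewrite -!bigcup_mkord => -[j /= jm ov].
  have [Fx|nF] := pselect (F x); first by left.
  right; exists j => //=; rewrite /Z/=.
  set q := rat_time j in ov *; have q0 : 0 < q := rat_time_gt0 j.
  have Nq : (N n j)%:R * tau n <= q.
    by rewrite -ler_pdivlMr// truncn_le divr_ge0 ?ltW.
  have hr : normc (rs r (tau n) (N n j) x) <= q * (a / 2).
    rewrite /riemann_sum; under eq_bigr do rewrite ho.
    rewrite -mulr_sumr normcM normcR ger0_norm ?(ltW tau0)//.
    apply: (@le_trans _ _ (tau n * ((N n j)%:R * (a / 2)))).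
      by rewrite ler_pM2l//; exact: hm.
    by rewrite mulrCA (mulrA _ (tau n)) ler_pM2r.
  have := normcD (B 1 r q x - rs r (tau n) (N n j) x) (rs r (tau n) (N n j) x).
  rewrite subrK; rewrite /over/= -/q in ov; by lra.
have mU : measurable (\big[setU/set0]_(j < m) Z n j) by exact: bigsetU_measurable.
rewrite (le_trans (measureU2 _ mF mU))//.
apply: leeD.
  rewrite -(@lee_pmul2l _ (a / 2)%:E) ?lte_fin// muleA -EFinM.
  rewrite (_ : a / 2 * (2 / a) = 1) ?mul1e; first exact: (filled_measure dsn Lr a20).
  by field; rewrite gt_eqF.
apply: (le_trans (Boole_inequality _ _)); first by move=> j _; exact: mZ.
apply: (@le_trans _ _ (\sum_(j < m) (e / m.+1%:R)%:E)%E).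
  by apply: lee_sum => j _; exact: Zn.
rewrite sumEFin lee_fin sumr_const card_ord -(mulr_natr (e / m.+1%:R)) -mulrA.
by rewrite ler_piMr ?(ltW e0)// mulrC ler_pdivrMr// mul1r ler_nat.
Qed.

(** Continuity from below gives the countable union. For a general t, rational q < t are used: the
    integral over [0, q] is close in L^1, hence in measure, and q a <= t a. The set [E] is fixed
    before t; only the null set depends on t. *)
Lemma orbit_maximal_inequality a r : 0 < a -> cLp mu 1 r -> exists E,
  [/\ measurable E, (mu E <= (2 / a)%:E * cnorm mu 1 r)%E &
   forall t, 0 < t -> \forall x \ae mu, ~ E x -> normc (B 1 r t x) <= t * a].
Proof.
move=> a0 Lr; pose E := \bigcup_j over a r j; exists E; split.
- by apply: bigcupT_measurable => j; exact: mover.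
- rewrite /E -bigcup_bigsetU_bigcup.
  have mU k : measurable (\big[setU/set0]_(i < k.+1) over a r i).
    by apply: bigsetU_measurable => j _; exact: mover.
  have cv := @nondecreasing_cvg_mu _ _ _ mu (fun k => \big[setU/set0]_(i < k.+1) over a r i)
    mU (bigcupT_measurable _ mU) _.
  have nd : {homo (fun k => \big[setU/set0]_(i < k.+1) over a r i) : n m / (n <= m)%N >-> (n <= m)%O}.
    move=> n m nm; apply/subsetPset; rewrite -!bigcup_mkord => x [j /= jn ov].
    by exists j => //=; rewrite (leq_trans jn).
  rewrite -(cvg_lim _ (cv nd))//; apply: lime_le; first by apply/cvg_ex; eexists; exact: (cv nd).
  by apply: nearW => k; exact: orbit_maximal_finite.
move=> t t0.
have LB s : 0 < s -> cmeasurable (B 1 r s).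
  by move=> s0; exact: cLp_measurable (orbit_integral_Lp (lexx 1) Lr s0).
apply: ae_le_of_approx => e eta e0 eta0.
have [del del0 Hd] := cnorm_small_set mu (@ltr01 R) e0 eta0.
pose M := orbit_bound 1 r; have M0 : 0 <= M := orbit_bound_ge0 1 r.
have M10 : 0 < M + 1 by rewrite ltr_wpDl.
(* Any rational q in this gap is positive and satisfies M (t - q) <= del. *)
have lt_t : Num.max 0 (t - del / (M + 1)) < t.
  by rewrite gt_max t0/= ltrBlDr ltrDl divr_gt0.
have [q] := rat_in_itvoo lt_t; rewrite in_itv/= gt_max => /andP[/andP[q0 qd] qt].
pose j := pickle q.
have jE : rat_time j = ratr q by rewrite /rat_time /j pickleK q0.
exists [set x | e <= normc (B 1 r t x - B 1 r (ratr q) x)]; split.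
- by apply: measurable_normc_ge; apply: cmeasurableB; exact: LB.
- apply: Hd; first by apply: cmeasurableB; exact: LB.
  apply: (le_trans (orbit_integral_lip (lexx 1) Lr q0 (ltW qt))); rewrite lee_fin.
  apply: (@le_trans _ _ ((M + 1) * (del / (M + 1)))); last by rewrite mulrC divfK// gt_eqF.
  by rewrite ler_pM// ?subr_ge0 ?(ltW qt)// ?lerDl//; lra.
apply: nearW => x nE nZ.
have h1 : normc (B 1 r (ratr q) x) <= ratr q * a.
  rewrite leNgt; apply/negP => h; apply: nE; exists j => //.
  by rewrite /over/= jE.
have h2 : normc (B 1 r t x - B 1 r (ratr q) x) < e by rewrite ltNge; apply/negP.
have := normcD (B 1 r t x - B 1 r (ratr q) x) (B 1 r (ratr q) x); rewrite subrK => h3.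
have h4 : ratr q * a <= t * a by rewrite ler_pM2r// ltW.
by lra.
Qed.

End LocalErgodic.

(** * Almost uniform convergence *)

(** Two windows of length N at distance m: the common terms cancel, and only m terms at each end
    survive, whether or not the windows meet. *)
Lemma shift_sum (V : zmodType) (F : nat -> V) (m N : nat) :
  \sum_(k < N) (F (k + m)%N - F k) = \sum_(k < m) (F (N + k)%N - F k).
Proof.
elim: N => [|N ih].
  by rewrite big_ord0 big1// => k _; rewrite add0n subrr.
rewrite big_ord_recr/= ih; elim: m {ih} => [|m ih].
  by rewrite !big_ord0 addn0 subrr addr0.
rewrite !big_ord_recr/= -ih ?addnS ?addSn -[LHS]addrA -[RHS]addrA; congr (_ + _).
by rewrite [LHS]addrACA [RHS]addrACA [- F m - _]addrC.
Qed.

Section AlmostUniform.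
Context {d : measure_display} {Omega : measurableType d} {R : realType}.
Variable mu : {measure set Omega -> \bar R}.
Variables T Text : R -> (Omega -> R[i]) -> (Omega -> R[i]).
Hypotheses (sgT : ds_semigroup mu T) (scT : strongly_continuous_L1 mu T).
Hypothesis extT : forall s : R, 0 <= s -> ds_extension mu (T s) (Text s).
Implicit Types (f g h : Omega -> R[i]) (p : R).

Local Notation dsT := (sg_ds sgT).
Local Notation B := (orbit_integral mu Text).
Local Notation rs f := (riemann_sum (fun s => Text s f)).

Let truncn_div (c : R) n : 0 < c -> Num.truncn (c / (c / n.+1%:R)) = n.+1.
Proof.
move=> c0; rewrite (_ : c / (c / n.+1%:R) = n.+1%:R) ?natrK//.
by field; rewrite ?pnatr_eq0 ?gt_eqF.
Qed.

(* The integral [\int_0^r T_u h du] of a bounded function [h] is Lipschitz along the orbit: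
   [T_s] shifts it, and the shifted and unshifted integrals overlap. *)
Lemma orbit_integral_orbit_lip h (c r s : R) : cLp mu 1 h -> 0 <= c ->
  (\forall x \ae mu, normc (h x) <= c) -> 0 < r -> 0 <= s ->
  \forall x \ae mu, normc (T s (B 1 h r) x - B 1 h r x) <= 2 * c * s.
Proof.
move=> Lh c0 hc r0; rewrite le_eqVlt => /predU1P[<-|s0].
  have LB := orbit_integral_Lp sgT scT extT (lexx 1) Lh r0.
  case: sgT => _ T0 _; apply: filterS (T0 _ LB) => x ->.
  by rewrite subrr normc0 mulr0.
set b := B 1 h r.
have Lb : cLp mu 1 b := orbit_integral_Lp sgT scT extT (lexx 1) Lh r0.
have LTb := sg_L1 sgT (ltW s0) Lb.
suff : \forall x \ae mu, setT x -> normc (T s b x - b x) <= 2 * c * s.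
  by apply: filterS => x; exact.
apply: ae_le_of_approx => e eta e0 eta0.
have e20 : 0 < e / 2 by rewrite divr_gt0.
have eta20 : 0 < eta / 2 by rewrite divr_gt0.
have [del del0 Hd] := cnorm_small_set mu (@ltr01 R) e20 eta20.
(* The mesh is s/(n+1), so that [T s] moves sampling points by exactly n + 1 places. *)
have [n _ /(_ n (leqnn n))] := riemann_cvg sgT scT extT (lexx 1) Lh r0 s0 del0.
rewrite /= -/b; set tau := s / n.+1%:R; set N := Num.truncn _ => close.
have tau0 : 0 < tau by rewrite divr_gt0.
have nt : n.+1%:R * tau = s by rewrite /tau mulrC divfK// pnatr_eq0.
have Lrs : cLp mu 1 (rs h tau N) := riemann_sum_Lp sgT extT N (lexx 1) Lh (ltW tau0).
have LTrs := sg_L1 sgT (ltW s0) Lrs.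
have mbrs : cmeasurable (fun x => b x - rs h tau N x).
  by apply: cmeasurableB; [exact: cLp_measurable Lb|exact: cLp_measurable Lrs].
have mTbrs : cmeasurable (fun x => T s b x - T s (rs h tau N) x).
  by apply: cmeasurableB; [exact: cLp_measurable LTb|exact: cLp_measurable LTrs].
have close' := le_trans (ds_dist (dsT (ltW s0)) Lb Lrs) close.
exists ([set x | e / 2 <= normc (b x - rs h tau N x)] `|`
        [set x | e / 2 <= normc (T s b x - T s (rs h tau N) x)]); split.
- by apply: measurableU; exact: measurable_normc_ge.
- rewrite (le_trans (measureU2 _ _ _))//; try exact: measurable_normc_ge.
  by rewrite (splitr eta) EFinD leeD//; exact: Hd.
pose F (k : nat) := T (k%:R * tau) h.
have kt (k : nat) : 0 <= k%:R * tau by rewrite mulr_ge0// ltW.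
have LF k : cLp mu 1 (F k) := sg_L1 sgT (kt k) Lh.
have Fc : \forall x \ae mu, forall k, normc (F k x) <= c.
  by apply: ae_foralln => k; exact: (ds_bound (dsT (kt k)) Lh c0 hc).
have TextF : \forall x \ae mu, forall k : nat, Text (k%:R * tau) h x = F k x.
  by apply: ae_foralln => k; exact: (ext_L1 (extT (kt k)) Lh).
have TF : \forall x \ae mu, forall k, T s (F k) x = F (k + n.+1)%N x.
  apply: ae_foralln => k; case: sgT => _ _ sg.
  have := sg s (k%:R * tau) h (ltW s0) (kt k) Lh.
  rewrite (_ : s + k%:R * tau = (k + n.+1)%:R * tau); first by apply: filterS => x /esym.
  by rewrite natrD mulrDl nt addrC.
have LtF k : cLp mu 1 (fun x => tau%:C * F k x) by apply: cLpZ.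
have TZ : \forall x \ae mu, forall k, T s (fun x => tau%:C * F k x) x = tau%:C * T s (F k) x.
  by apply: ae_foralln => k; exact: (ds_scale (dsT (ltW s0)) _ (LF k)).
have Trs : \forall x \ae mu, T s (rs h tau N) x = T s (fun x => \sum_(k < N) tau%:C * F k x) x.
  apply: (ds_ae (dsT (ltW s0)) Lrs); first by apply: cLp_sum.
  by apply: filterS TextF => x hx; apply: eq_bigr => k _; rewrite hx.
have Tsum := ds_sum (dsT (ltW s0)) N LtF.
have H1 : \forall x \ae mu, T s (rs h tau N) x = tau%:C * \sum_(k < N) F (k + n.+1)%N x.
  apply: filterS3 Trs Tsum (filterI TZ TF) => x -> -> [hZ hT].
  by rewrite mulr_sumr; apply: eq_bigr => k _; rewrite hZ hT.
apply: filterS3 Fc TextF H1 => x hF hT h1 _ nZ.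
have d1 : normc (b x - rs h tau N x) < e / 2.
  by rewrite ltNge; apply/negP => h2; apply: nZ; left.
have d2 : normc (T s b x - T s (rs h tau N) x) < e / 2.
  by rewrite ltNge; apply/negP => h2; apply: nZ; right.
have d3 : normc (T s (rs h tau N) x - rs h tau N x) <= 2 * c * s.
  rewrite h1 /riemann_sum; under [X in _ - X]eq_bigr do rewrite hT.
  (* After cancellation n + 1 differences remain, each at most 2c, with weight tau = s/(n+1). *)
  rewrite -mulr_sumr -mulrBr -sumrB (shift_sum (fun k => F k x)) normcM normcR ger0_norm ?(ltW tau0)//.
  apply: (@le_trans _ _ (tau * (\sum_(k < n.+1) (2 * c)))).
    rewrite ler_pM2l//; apply: (le_trans (normc_sum _ _)); apply: ler_sum => k _.
    by rewrite (le_trans (normcB _ _))// mulr2n mulrDl mul1r lerD.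
  rewrite sumr_const card_ord -(mulr_natr (2 * c)) -[X in _ <= _ * X]nt.
  by rewrite mulrCA (mulrC tau).
rewrite [X in normc X](_ : _ = (T s b x - T s (rs h tau N) x) +
   ((T s (rs h tau N) x - rs h tau N x) - (b x - rs h tau N x))); last by ring.
have := normcD (T s b x - T s (rs h tau N) x) ((T s (rs h tau N) x - rs h tau N x) - (b x - rs h tau N x)).
have := normcB (T s (rs h tau N) x - rs h tau N x) (b x - rs h tau N x).
by lra.
Qed.

(** Half of [eta] replaces f by a bounded integrable h, and half replaces h by its average over
    [0, r], with r so small that the orbit of h has hardly moved. Dividing the Lipschitz constant 2c
    of the integral by r gives C. *)
Lemma lip_orbit_dense f (eta : R) : cLp mu 1 f -> 0 < eta -> exists g (C : R),
  [/\ cLp mu 1 g, 0 <= C, (cdist mu 1 f g <= eta%:E)%E &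
   forall s, 0 <= s -> \forall x \ae mu, normc (T s g x - g x) <= C * s].
Proof.
move=> Lf eta0; have eta20 : 0 < eta / 2 by rewrite divr_gt0.
have eta40 : 0 < eta / 4 by rewrite divr_gt0.
have [h [c [c0 Lh _ hc fh]]] := cLp_dense (lexx 1) eta20 Lf.
have [r r0 Hr] := sg_continuous0 sgT scT Lh eta40.
set b := B 1 h r.
have Lb : cLp mu 1 b := orbit_integral_Lp sgT scT extT (lexx 1) Lh r0.
pose g x := (r^-1)%:C * b x.
have Lg : cLp mu 1 g by exact: cLpZ.
exists g, (2 * c / r); split => //.
- by rewrite divr_ge0 ?mulr_ge0// ltW.
- have -> : eta%:E = ((eta / 2)%:E + (eta / 2)%:E)%E :> \bar R by rewrite -EFinD -splitr.
  apply: (le_trans (cdist_triangle mu (lexx 1) (cLp_measurable Lf) (cLp_measurable Lh) (cLp_measurable Lg))).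
  apply: leeD => //.
  have re : 0 < r * (eta / 4) by rewrite mulr_gt0.
  have [n _ /(_ n (leqnn n))] := riemann_cvg sgT scT extT (lexx 1) Lh r0 r0 re.
  rewrite /= truncn_div// -/b; set tau := r / n.+1%:R => close.
  have tau0 : 0 < tau by rewrite divr_gt0.
  have nt : n.+1%:R * tau = r by rewrite /tau mulrC divfK// pnatr_eq0.
  have Lrs : cLp mu 1 (rs h tau n.+1) := riemann_sum_Lp sgT extT n.+1 (lexx 1) Lh (ltW tau0).
  pose hr x := r%:C * h x.
  have Lhr : cLp mu 1 hr by exact: cLpZ.
  (* As the n + 1 steps fill [0, r], the difference is a sum of terms tau (h - T_(k tau) h), each
     small by the choice of r. *)
  have close2 : (cdist mu 1 hr (rs h tau n.+1) <= (r * (eta / 4))%:E)%E.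
    pose D (k : nat) x := h x - Text (k%:R * tau) h x.
    have kt (k : nat) : 0 <= k%:R * tau by rewrite mulr_ge0// ltW.
    have LT k : cLp mu 1 (Text (k%:R * tau) h) := ext_Lp (dsT (kt k)) (extT (kt k)) (lexx 1) Lh.
    have LD k : cLp mu 1 (D k) by exact: (cLpB (lexx 1) Lh).
    have mD k := cLp_measurable (LD k).
    have E : cdist mu 1 hr (rs h tau n.+1) = cnorm mu 1 (fun x => \sum_(k < n.+1) tau%:C * D k x).
      apply: eq_Lnorm => x; congr (normc _)%:E.
      rewrite /hr /riemann_sum -!mulr_sumr sumrB mulrBr; congr (_ - _).
      by rewrite sumr_const card_ord -mulr_natl mulrA -{1}nt rmorphM/= rmorph_nat (mulrC n.+1%:R).
    rewrite E; apply: (le_trans (cnorm_sum mu _ (lexx 1) _)); first by move=> k; exact: cmeasurableZ.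
    apply: (@le_trans _ _ (\sum_(k < n.+1) (tau * (eta / 4))%:E)%E).
      apply: lee_sum => k _; rewrite cnormZ// normcR ger0_norm ?(ltW tau0)// [leRHS]EFinM.
      rewrite lee_pmul2l//; have kr : k%:R * tau <= r.
        by rewrite -nt ler_pM2r// ler_nat ltnW.
      apply: le_trans (Hr _ (kt k) kr); rewrite cdistC.
      rewrite le_eqVlt; apply/orP; left; apply/eqP; apply: eq_cnorm => //.
        by apply: cmeasurableB; [exact: cLp_measurable Lh|exact: cLp_measurable (sg_L1 sgT (kt k) Lh)].
      by apply: filterS (ext_L1 (extT (kt k)) Lh) => x; rewrite /D => ->.
    by rewrite sumEFin lee_fin sumr_const card_ord -(mulr_natl (tau * _)) mulrA nt.
  have close3 : (cdist mu 1 hr b <= (r * (eta / 2))%:E)%E.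
    apply: (le_trans (cdist_triangle mu (lexx 1) (cLp_measurable Lhr) (cLp_measurable Lrs) (cLp_measurable Lb))).
    rewrite [X in (_ + X)%E]cdistC (le_trans (leeD close2 close))// -EFinD lee_fin; lra.
  have -> : cdist mu 1 h g = ((r^-1)%:E * cdist mu 1 hr b)%E.
    rewrite /cdist -[in RHS](ger0_norm (_ : 0 <= r^-1)) ?invr_ge0 ?(ltW r0)// -normcR -cnormZ//.
      apply: eq_Lnorm => x; congr (normc _)%:E.
      by rewrite mulrBr /hr mulrA -rmorphM mulVf ?gt_eqF// mul1r.
    by apply: cmeasurableB; [exact: cLp_measurable Lhr|exact: cLp_measurable Lb].
  by rewrite lee_pdivrMl.
move=> s s0.
have hc' : \forall x \ae mu, normc (h x) <= c by exact: nearW.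
have := orbit_integral_orbit_lip Lh c0 hc' r0 s0.
apply: filterS2 (ds_scale (dsT s0) (r^-1)%:C Lb) => x; rewrite -/b => E H.
rewrite /g E -mulrBr normcM normcR ger0_norm ?invr_ge0 ?(ltW r0)//.
by rewrite ler_pdivrMl// (le_trans H)// le_eqVlt; apply/orP; left; apply/eqP; field; rewrite gt_eqF.
Qed.

(** The level is a = e/4 because four terms are bounded by it: the average of r, r itself, the
    average of the truncation f2, and f2 itself. The Lipschitz orbit of g contributes C t. *)
Lemma averages_close p f (e eta : R) : 1 <= p -> cLp mu p%:E f -> 0 < e -> 0 < eta ->
  exists (C : R) E, [/\ 0 <= C, measurable E, (mu E <= eta%:E)%E &
   forall t, 0 < t -> \forall x \ae mu, ~ E x ->
     normc (B p f t x - t%:C * f x) <= t * (C * t + e)].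
Proof.
move=> p1 Lf e0 eta0; pose a := e / 4.
have a0 : 0 < a by rewrite divr_gt0.
have eta20 : 0 < eta / 2 by rewrite divr_gt0.
have [del del0 Hdel] := cnorm_small_set mu (@ltr01 R) a0 eta20.
pose f2 := ctrunc (fun=> a) f; pose f1 x := f x - f2 x.
have Lf1 : cLp mu 1 f1 := cLp_sub_ctrunc p1 a0 Lf.
have mf := cLp_measurable Lf.
have mf2 : cmeasurable f2 by exact: cmeasurable_ctrunc.
have f2a x : normc (f2 x) <= a by rewrite normc_ctrunc ?(ltW a0)// ge_min lexx orbT.
have Lf2 : cLp mu +oo f2 by apply: (cLpy (ltW a0) mf2); exact: nearW.
(* Both parts of the exceptional set get measure at most eta/2: the maximal inequality by the second
   entry, the set where |r| >= a by the first. *)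
pose eps := Num.min del (a * eta / 4).
have eps0 : 0 < eps by rewrite lt_min del0 divr_gt0// mulr_gt0.
have [g [C [Lg C0 f1g gC]]] := lip_orbit_dense Lf1 eps0.
pose r x := f1 x - g x.
have Lr : cLp mu 1 r by exact: (cLpB (lexx 1)).
have r_small : (cnorm mu 1 r <= eps%:E)%E by exact: f1g.
have [E1 [mE1 E1s maxE1]] := orbit_maximal_inequality sgT scT extT a0 Lr.
pose E2 := [set x | a <= normc (r x)].
have mE2 : measurable E2 by apply: measurable_normc_ge; exact: cLp_measurable Lr.
exists C, (E1 `|` E2); split => //.
- exact: measurableU.
- rewrite (le_trans (measureU2 _ mE1 mE2))// (splitr eta) EFinD leeD//.
    rewrite (le_trans E1s)//.
    apply: (@le_trans _ _ ((2 / a)%:E * (a * eta / 4)%:E)%E).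
      rewrite lee_pmul2l ?lte_fin ?divr_gt0// (le_trans r_small)// lee_fin.
      by rewrite /eps ge_min lexx orbT.
    by rewrite -EFinM lee_fin le_eqVlt; apply/orP; left; apply/eqP; field; rewrite gt_eqF.
  apply: Hdel; first exact: cLp_measurable Lr.
  by rewrite (le_trans r_small)// lee_fin /eps ge_min lexx.
move=> t t0; apply: ae_le_of_approx => e' eta' e'0 eta'0.
have e20 : 0 < e' / 2 by rewrite divr_gt0.
have h20 : 0 < eta' / 2 by rewrite divr_gt0.
have p0 : 0 < p by rewrite (lt_le_trans _ p1).
have [d1 d10 Hd1] := cnorm_small_set mu p0 e20 h20.
have [d2 d20 Hd2] := cnorm_small_set mu (@ltr01 R) e20 h20.
have c1 := riemann_cvg sgT scT extT p1 Lf t0 t0 d10.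
have c2 := riemann_cvg sgT scT extT (lexx 1) Lr t0 t0 d20.
have [n _ /(_ n (leqnn n))] := filterI c1 c2.
rewrite /= truncn_div//; set tau := t / n.+1%:R => -[close1 close2].
have tau0 : 0 < tau by rewrite divr_gt0.
have nt : n.+1%:R * tau = t by rewrite /tau mulrC divfK// pnatr_eq0.
have kt (k : nat) : 0 <= k%:R * tau by rewrite mulr_ge0// ltW.
have m1 : cmeasurable (fun x => B p f t x - rs f tau n.+1 x).
  apply: cmeasurableB; first exact: cLp_measurable (orbit_integral_Lp sgT scT extT p1 Lf t0).
  exact: cLp_measurable (riemann_sum_Lp sgT extT n.+1 p1 Lf (ltW tau0)).
have m2 : cmeasurable (fun x => B 1 r t x - rs r tau n.+1 x).
  apply: cmeasurableB; first exact: cLp_measurable (orbit_integral_Lp sgT scT extT (lexx 1) Lr t0).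
  exact: cLp_measurable (riemann_sum_Lp sgT extT n.+1 (lexx 1) Lr (ltW tau0)).
exists ([set x | e' / 2 <= normc (B p f t x - rs f tau n.+1 x)] `|`
        [set x | e' / 2 <= normc (B 1 r t x - rs r tau n.+1 x)]); split.
- by apply: measurableU; exact: measurable_normc_ge.
- rewrite (le_trans (measureU2 _ _ _))//; try exact: measurable_normc_ge.
  by rewrite (splitr eta') EFinD leeD//; [exact: Hd1|exact: Hd2].
(* The decomposition is made at the sampling times, where linearity on L^1 + L^oo suffices. *)
have split_orbit : \forall x \ae mu, forall k : nat, Text (k%:R * tau) f x =
    T (k%:R * tau) g x + Text (k%:R * tau) r x + Text (k%:R * tau) f2 x.
  apply: ae_foralln => k; have ex := extT (kt k).
  have Lgr : L1_plus_Loo mu (fun x => g x + r x) by apply: L1_sub_L1_plus_Loo; exact: (cLpD (lexx 1)).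
  have := ext_add ex Lgr (Loo_sub_L1_plus_Loo Lf2).
  rewrite (_ : (fun y => g y + r y + f2 y) = f); last first.
    by apply/funext => y; rewrite /r /f1; ring.
  have := ext_add ex (L1_sub_L1_plus_Loo Lg) (L1_sub_L1_plus_Loo Lr).
  by apply: filterS3 (ext_L1 ex Lg) => x -> -> ->.
have bound2 : \forall x \ae mu, forall k : nat, normc (Text (k%:R * tau) f2 x) <= a.
  apply: ae_foralln => k; apply: (ext_bound (extT (kt k)) mf2 (ltW a0)); exact: nearW.
have boundg : \forall x \ae mu, forall k : nat, normc (T (k%:R * tau) g x - g x) <= C * (k%:R * tau).
  by apply: ae_foralln => k; exact: gC.
apply: filterS3 split_orbit bound2 (filterI boundg (maxE1 t t0)) => x sp b2 [bg mx] nE nZ.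
have y1 : normc (B p f t x - rs f tau n.+1 x) < e' / 2.
  by rewrite ltNge; apply/negP => h; apply: nZ; left.
have y2 : normc (B 1 r t x - rs r tau n.+1 x) < e' / 2.
  by rewrite ltNge; apply/negP => h; apply: nZ; right.
have y3 : normc (B 1 r t x) <= t * a by apply: mx => h; apply: nE; left.
have y4 : normc (r x) < a by rewrite ltNge; apply/negP => h; apply: nE; right.
have sumC (z : R[i]) : \sum_(k < n.+1) tau%:C * z = t%:C * z.
  rewrite sumr_const card_ord -(mulr_natl (tau%:C * z)) mulrA; congr (_ * _).
  by rewrite -[in RHS]nt [RHS]rmorphM rmorph_nat.
have sumR (z : R) : \sum_(k < n.+1) tau * z = t * z.
  by rewrite sumr_const card_ord -(mulr_natl (tau * z)) mulrA nt.
pose sg := \sum_(k < n.+1) tau%:C * (T (k%:R * tau) g x - g x).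
pose s2 := \sum_(k < n.+1) tau%:C * Text (k%:R * tau) f2 x.
have y5 : normc sg <= t * (C * t).
  rewrite (le_trans (normc_sum _ _))// -sumR; apply: ler_sum => k _.
  rewrite normcM normcR ger0_norm ?(ltW tau0)// ler_pM2l// (le_trans (bg k))//.
  by rewrite ler_wpM2l// -[leRHS]nt ler_pM2r// ler_nat ltnW.
have y6 : normc s2 <= t * a.
  rewrite (le_trans (normc_sum _ _))// -sumR; apply: ler_sum => k _.
  by rewrite normcM normcR ger0_norm ?(ltW tau0)// ler_pM2l.
have rsE : rs f tau n.+1 x = sg + t%:C * g x + rs r tau n.+1 x + s2.
  rewrite -sumC /sg /s2 /riemann_sum -!big_split/=; apply: eq_bigr => k _.
  by rewrite sp; ring.
have fE : f x = g x + r x + f2 x by rewrite /r /f1; ring.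
have y7 : normc (t%:C * r x) <= t * a.
  by rewrite normcM normcR ger0_norm ?(ltW t0)// ler_pM2l// ltW.
have y8 : normc (t%:C * f2 x) <= t * a.
  by rewrite normcM normcR ger0_norm ?(ltW t0)// ler_pM2l.
(* The Riemann sum of r is traded for its integral, the only form to which the maximal inequality
   applies; the two differences [B - rs] are small off [Z]. *)
have -> : B p f t x - t%:C * f x = (B p f t x - rs f tau n.+1 x) + (sg +
   (- (B 1 r t x - rs r tau n.+1 x) + (B 1 r t x + (- (t%:C * r x) + (s2 + - (t%:C * f2 x)))))).
  by rewrite rsE fE; ring.
have te : t * (C * t + e) = t * (C * t) + (t * a + t * a + t * a + t * a) by rewrite /a; field.
rewrite te.
apply: (le_trans (normcD _ _)); apply: (le_trans (lerD (ltW y1) (normcD _ _))).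
apply: (le_trans (lerD (lexx _) (lerD y5 (normcD _ _)))); rewrite normcN.
apply: (le_trans (lerD (lexx _) (lerD (lexx _) (lerD (ltW y2) (normcD _ _))))).
have z1 := normcD (- (t%:C * r x)) (s2 + - (t%:C * f2 x)).
have z2 := normcD s2 (- (t%:C * f2 x)); rewrite !normcN in z1 z2.
lra.
Qed.

End AlmostUniform.

Theorem theorem4p2 (d : measure_display) (Omega : measurableType d)
    (R : realType) (mu : {measure set Omega -> \bar R})
    (mu_sigma_finite : sigma_finite [set: Omega] mu)
    (mu_infinite : mu [set: Omega] = +oo%E)
    (T : R -> (Omega -> R[i]%C) -> (Omega -> R[i]%C))
    (T_semigroup : ds_semigroup mu T)
    (T_continuous : strongly_continuous_L1 mu T)
    (Text : R -> (Omega -> R[i]%C) -> (Omega -> R[i]%C))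
    (T_extension : forall s : R, 0 <= s -> ds_extension mu (T s) (Text s))
    (p : R) (hp : 1 <= p) (f : Omega -> R[i]%C) (hf : cLp mu p%:E f) :
  cvg_au mu (0 : R)^'+ (fun t : R => ds_average mu p%:E Text t f) f.
Proof.
move=> e e0.
(* One exceptional set for each accuracy 2^-k, of measure at most e / 2^(k+1); their union has
   measure at most [e] and serves all accuracies. *)
have /choice[CE HCE] : forall k : nat, exists CE : R * set Omega, [/\ 0 <= CE.1, measurable CE.2,
   (mu CE.2 <= (e / (2 ^ k.+1)%:R)%:E)%E & forall t, 0 < t -> \forall x \ae mu, ~ CE.2 x ->
     normc (orbit_integral mu Text p f t x - t%:C * f x) <= t * (CE.1 * t + 2^-1 ^+ k)].
  move=> k; have k0 : 0 < 2^-1 ^+ k :> R by rewrite exprn_gt0 ?invr_gt0.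
  have h0 : 0 < e / (2 ^ k.+1)%:R by rewrite divr_gt0// ltr0n expn_gt0.
  by have [C [E HE]] := averages_close T_semigroup T_continuous T_extension hp hf k0 h0; exists (C, E).
pose E := \bigcup_k (CE k).2.
have mE : measurable E by apply: bigcupT_measurable => k; case: (HCE k).
have muE : (mu E <= e%:E)%E.
  apply: (le_trans (generalized_Boole_inequality _ _ mE)); first by move=> k; case: (HCE k).
  apply: le_trans (epsilon_trick0 xpredT (ltW e0)).
  by apply: lee_nneseries => k _ //; case: (HCE k).
exists (~` E); split; [exact: measurableC|by rewrite setCK|].
apply/ge0_cvge0P => [t|eps eps0]; first exact: cnorm_ge0.
have [k hk] : exists k, 2^-1 ^+ k <= eps / 2.
  have cv : 2^-1 ^+ n @[n --> \oo] --> (0 : R).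
    by apply: cvg_expr; rewrite ger0_norm ?invr_ge0// invf_lt1// ltr1n.
  have [k _ hk] := cvgr_le _ cv _ (divr_gt0 eps0 (@ltr0n R 2)).
  by exists k; apply: hk => /=.
have [C0 _ _ HC] := HCE k; set C := (CE k).1 in C0 HC.
have C10 : 0 < C + 1 by rewrite ltr_wpDl.
near=> t.
have t0 : 0 < t by near: t; exact: nbhs_right_gt.
(* Makes the Lipschitz term C t at most eps/2, the other half being 2^-k. *)
have tC : t <= eps / 2 / (C + 1).
  by near: t; apply: nbhs_right_le; rewrite !divr_gt0.
(* The norm is an essential supremum for this one t, so a null set depending on t is allowed. *)
apply: cnormy_le; first exact: ltW.
apply: filterS (HC t t0) => x hx; rewrite normcM normcR indicE.
have [|_] := boolP (x \in ~` E); last by rewrite normr0 mulr0 ltW.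
rewrite inE normr1 mulr1 => nE.
have {}hx := hx (fun h => nE (ex_intro2 _ _ k I h)).
rewrite normc_distC /ds_average -/(orbit_integral mu Text p f t).
have -> : (t^-1)%:C * orbit_integral mu Text p f t x - f x =
    (t^-1)%:C * (orbit_integral mu Text p f t x - t%:C * f x).
  by rewrite mulrBr mulrA -rmorphM mulVf ?gt_eqF// mul1r.
rewrite normcM normcR ger0_norm ?invr_ge0 ?(ltW t0)// ler_pdivrMl// (le_trans hx)//.
rewrite ler_pM2l// [leRHS](splitr eps) lerD//.
apply: (@le_trans _ _ ((C + 1) * (eps / 2 / (C + 1)))).
  by rewrite ler_pM ?(ltW t0)// lerDl.
by rewrite mulrC divfK// gt_eqF.
Unshelve. all: by end_near. Qed.
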